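(* Let $\Psi$ satisfy the standing assumption on $\Psi$ below, let $\{H_k\}_{k=1}^\infty=\{(h_{s,k},h_{f,k})\}$ be two-timescale admissible with $\sum_{k=1}^\infty h_{f,k}^{1+\varrho}<\infty$ for some $\varrho\in[1,\infty)$, let $\mathbf X=(\mathbf x_s,\mathbf x_f)$ be a solution of the stochastic simulator (S) below, and let $\hat\Omega\subset\Omega$ be such that for almost every $\omega\in\hat\Omega$ the hybrid sequence $\mathbf X(\omega)$ is bounded and complete. Then for almost every $\omega\in\hat\Omega$, the pair $(\mathbf x_s(\omega),\{h_{s,k}\}_{k=1}^\infty)$ is an asymptotic simulation of $\mathcal H_{\mathrm{HB}}$, and $\omega$-limit set of $\mathbf x_s(\omega)$ is contained in $\mathcal M:=\mathcal Q^*\times\{0\}\times[0,2T]$.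
   Context: Standing assumption on $\Psi$: $\Psi:\mathbb R^n\to\mathbb R$ is continuously differentiable, has compact sublevel sets and globally Lipschitz gradient, and, with $\Psi^*:=\min\Psi$, satisfies $\mathcal Q^*:=\{q:\Psi(q)=\Psi^*\}=\{q:\nabla\Psi(q)=0\}$; moreover $\Psi=\frac1N\sum_{i=1}^N\Psi_i$ with $N\in\mathbb Z_{\ge1}$ and each $\Psi_i:\mathbb R^n\to\mathbb R$ continuously differentiable. Hybrid heavy ball. Fix $\kappa,T>0$. State $\chi=(q,p,\tau)\in\mathbb R^{2n+1}$, $\xi\in\mathbb R^n$. $F_{\mathrm{HB}}(\chi,\xi):=(p,\,-\kappa p-\xi,\,\min\{1,2-\tau/T\})$; $G_{\mathrm{HB}}(\chi):=(q,0,0)$. $\mathcal H_{\mathrm{HB}}$ is the hybrid inclusion on $\mathbb R^{2n+1}$: $\chi\in C_{\mathrm{HB}}$, $\dot\chi=F_{\mathrm{HB}}(\chi,\nabla\Psi(q))$; $\chi\in D_{\mathrm{HB}}$, $\chi^+=G_{\mathrm{HB}}(\chi)$, where $C_{\mathrm{HB}}:=\{\chi:\langle\nabla\Psi(q),p\rangle\le0,\tau\ge T\}\cup\{\chi:\tau\le T\}$ and $D_{\mathrm{HB}}:=\{\chi:\langle\nabla\Psi(q),p\rangle\ge0,\tau\ge T\}$. Also $C:=\{(\chi,\xi):\langle\xi,p\rangle\le0,\tau\ge T\}\cup\{(\chi,\xi):\tau\le T\}$, $D:=\{(\chi,\xi):\langle\xi,p\rangle\ge0,\tau\ge T\}$.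 Stochastic simulator (S). Let $(\Omega,\mathcal F,\mathbb P)$ be a probability space and $\{\mathbf y_k\}_{k\ge1}$ i.i.d. random variables uniform on $\{1,\dots,N\}$; $\{\mathcal F_k\}$ is the minimal filtration generated by them, $\mathcal F_0=\{\emptyset,\Omega\}$. A collection $\omega\mapsto\mathbf X(\omega)=(\mathbf x_s(\omega),\mathbf x_f(\omega))$, with $\mathbf x_s=(\mathbf q,\mathbf p,\boldsymbol\tau)$, is a solution of (S) if for every $\omega$, $\mathbf X(\omega)$ is a complete hybrid sequence in $\mathbb R^{3n+1}$ such that: whenever $(k,j),(k+1,j)\in\mathrm{dom}\,\mathbf X(\omega)$, $\mathbf X(k,j)\in C$, $\mathbf x_s(k+1,j)=\mathbf x_s(k,j)+h_{s,k+1}F_{\mathrm{HB}}(\mathbf x_s(k,j),\mathbf x_f(k,j))$ and $\mathbf x_f(k+1,j)=\mathbf x_f(k,j)+h_{f,k+1}(\nabla\Psi_{\mathbf y_{k+1}}(\mathbf q(k,j))-\mathbf x_f(k,j))$; whenever $(k,j),(k,j+1)\in\mathrm{dom}\,\mathbf X(\omega)$, $\mathbf X(k,j)\in D$, $\mathbf x_s(k,j+1)=G_{\mathrm{HB}}(\mathbf x_s(k,j))$, $\mathbf x_f(k,j+1)=\mathbf x_f(k,j)$; and $\mathbf X$ is adapted: for each $k$, $\omega\mapsto\mathrm{gph}(\mathbf X(\omega))\cap(\{k\}\times\mathbb R\times\mathbb R^{3n+1})$ is $\mathcal F_k$-measurable. Hybrid sequences and asymptotic simulations. A compact hybrid sequence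 domain is $\bigcup_{j=0}^{J-1}(\{k_j,\dots,k_{j+1}\}\times\{j\})$ with integers $0=k_0\le\dots\le k_J$; a hybrid sequence domain is a union of a nondecreasing sequence of such sets; a hybrid sequence is a map on one; complete = unbounded domain; complete in the $k$- (resp. $j$-) direction = set of $k$'s (resp. $j$'s) in the domain unbounded. $\bar\jmath_k:=\inf\{j:(k+1,j)\in\mathrm{dom}\}$, $\bar k_j:=\inf\{k:(k,j+1)\in\mathrm{dom}\}$. $\limsup$ of a sequence = its set of accumulation points. The $\omega$-limit set of a hybrid sequence $\phi$ is the set of all $\lim_i\phi(k_i,j_i)$ with $(k_i,j_i)\in\mathrm{dom}\,\phi$, $k_i+j_i\to\infty$. For $\mathcal H=(C',F,D',G)$, $F_{C'}(x):=F(x)$ if $x\in C'$ else $\emptyset$; $G_{D'}$ analogously. A sequence $\{h_k\}$ is admissible if $h_k>0$, $h_k\to0$, $\sum h_k=\infty$; $\tau_k:=\sum_{i=0}^{k-1}h_{i+1}$, $m(t):=\max\{k:\tau_k\le t\}$. $(\phi,\{h_k\})$ is an asymptotic simulation of $\mathcal H$ if $\phi$ is a bounded complete hybrid sequence, $\{h_k\}$ is admissible, and: (1) if $\phi$ is complete in the $k$-direction there is a bounded sequence $\{f_k\}$ with $\limsup_k(\phi(k,\bar\jmath_k),f_k)\subset\mathrm{gph}(F_{C'})$ and, with $\hat f_{k+1}:=(\phi(k+1,\bar\jmath_k)-\phi(k,\bar\jmath_k))/h_{k+1}$, for each $T'>0$, $\lim_{n\to\infty}\sup_{n+1\le k\le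 m(\tau_n+T')}|\sum_{i=n}^{k-1}h_{i+1}(\hat f_{i+1}-f_i)|=0$; (2) if $\phi$ is complete in the $j$-direction, $\limsup_j(\phi(\bar k_j,j),\phi(\bar k_j,j+1))\subset\mathrm{gph}(G_{D'})$. $\{(h_{s,k},h_{f,k})\}\subset\mathbb R^2_{>0}$ is two-timescale admissible if both component sequences are admissible and $h_{s,k}/h_{f,k}\to0$. *)

(* Defs.v *)
From mathcomp Require Import all_boot all_order all_algebra all_classical all_reals all_analysis.
Import numFieldNormedType.Exports.
Set Implicit Arguments. Unset Strict Implicit. Unset Printing Implicit Defensive.
Import Order.TTheory GRing.Theory Num.Theory.
Local Open Scope classical_set_scope.
Local Open Scope ring_scope.

Section Defs.
Variable R : realType.

Definition dotr (n : nat) (u v : 'rV[R]_n) : R := \sum_(i < n) u 0 i * v 0 i.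
Definition enorm (n : nat) (u : 'rV[R]_n) : R := Num.sqrt (dotr u u).

Definition grad (n : nat) (f : 'rV[R]_n -> R) (q : 'rV[R]_n) : 'rV[R]_n :=
  \row_(i < n) ('d f q (delta_mx 0 i : 'rV[R]_n)).

Definition C1 (n : nat) (f : 'rV[R]_n -> R) : Prop :=
  (forall q, differentiable f q) /\ continuous (grad f).

Definition standing_assumption (n N : nat) (Psi : 'rV[R]_n -> R)
    (Psis : 'I_N -> 'rV[R]_n -> R) : Prop :=
  [/\ C1 Psi,
      (forall c : R, compact [set q | Psi q <= c]),
      (exists L : R, forall x y, enorm (grad Psi x - grad Psi y) <= L * enorm (x - y)),
      (forall q, (forall q', Psi q <= Psi q') <-> grad Psi q = 0) &
      [/\ (0 < N)%N,
      (forall q, Psi q = (N%:R)^-1 * \sum_(i < N) Psis i q) &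
      (forall i, C1 (Psis i))]].

Definition Qstar (n : nat) (Psi : 'rV[R]_n -> R) : set 'rV[R]_n :=
  [set q | forall q', Psi q <= Psi q'].

(* state chi = ((q, p), tau) in R^{2n+1} *)
Definition stateHB (n : nat) := ('rV[R]_n * 'rV[R]_n * R)%type.

Definition F_HB (n : nat) (kappa T : R) (chi : stateHB n) (xi : 'rV[R]_n) : stateHB n :=
  ((chi.1.2, - (kappa *: chi.1.2) - xi), Num.min 1 (2 - chi.2 / T)).

Definition G_HB (n : nat) (chi : stateHB n) : stateHB n := ((chi.1.1, 0), 0).

Definition C_HB (n : nat) (Psi : 'rV[R]_n -> R) (T : R) : set (stateHB n) :=
  [set chi | (dotr (grad Psi chi.1.1) chi.1.2 <= 0 /\ T <= chi.2) \/ chi.2 <= T].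

Definition D_HB (n : nat) (Psi : 'rV[R]_n -> R) (T : R) : set (stateHB n) :=
  [set chi | 0 <= dotr (grad Psi chi.1.1) chi.1.2 /\ T <= chi.2].

Definition Fflow_HB (n : nat) (Psi : 'rV[R]_n -> R) (kappa T : R) (chi : stateHB n)
  : stateHB n := F_HB kappa T chi (grad Psi chi.1.1).

Definition Cbig (n : nat) (T : R) : set (stateHB n * 'rV[R]_n) :=
  [set z | (dotr z.2 z.1.1.2 <= 0 /\ T <= z.1.2) \/ z.1.2 <= T].
Definition Dbig (n : nat) (T : R) : set (stateHB n * 'rV[R]_n) :=
  [set z | 0 <= dotr z.2 z.1.1.2 /\ T <= z.1.2].

Definition Mset (n : nat) (Psi : 'rV[R]_n -> R) (T : R) : set (stateHB n) :=
  [set chi | Qstar Psi chi.1.1 /\ chi.1.2 = 0 /\ 0 <= chi.2 <= 2 * T].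

End Defs.

Definition compact_hdom (E : set (nat * nat)) : Prop :=
  exists (J : nat) (kk : nat -> nat),
    [/\ kk 0%N = 0%N, (forall j, (j < J)%N -> (kk j <= kk j.+1)%N) &
        E = [set p | (p.2 < J)%N /\ (kk p.2 <= p.1 <= kk p.2.+1)%N]].

Definition hdom (E : set (nat * nat)) : Prop :=
  exists Es : nat -> set (nat * nat),
    [/\ (forall i, compact_hdom (Es i)), (forall i, Es i `<=` Es i.+1) &
        E = \bigcup_i Es i].

Record hseq (V : Type) := HSeq {
  hd : set (nat * nat);
  hv : nat -> nat -> V;      (* values (only meaningful on hd) *)
  hdP : hdom hd }.

Definition hmap (V W : Type) (f : V -> W) (phi : hseq V) : hseq W :=
  @HSeq W (hd phi) (fun k j => f (hv phi k j)) (hdP phi).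

Definition hcomplete V (phi : hseq V) : Prop :=
  ~ exists M : nat, forall k j, hd phi (k, j) -> (k + j <= M)%N.
Definition hcomplete_k V (phi : hseq V) : Prop :=
  forall M : nat, exists k j, hd phi (k, j) /\ (M <= k)%N.
Definition hcomplete_j V (phi : hseq V) : Prop :=
  forall M : nat, exists k j, hd phi (k, j) /\ (M <= j)%N.

Definition hbounded (R : realType) (V : normedModType R) (phi : hseq V) : Prop :=
  exists M : R, forall k j, hd phi (k, j) -> `|hv phi k j| <= M.

(* jbar_k := inf { j | (k+1, j) in dom },  kbar_j := inf { k | (k, j+1) in dom }
   (the value for an empty set is irrelevant; it is never used then) *)
Definition jbar V (phi : hseq V) (k : nat) : nat :=
  xget 0%N [set j | hd phi (k.+1, j) /\ forall j', hd phi (k.+1, j') -> (j <= j')%N].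
Definition kbar V (phi : hseq V) (j : nat) : nat :=
  xget 0%N [set k | hd phi (k, j.+1) /\ forall k', hd phi (k', j.+1) -> (k <= k')%N].

Definition acc_pts (X : topologicalType) (u : nat -> X) : set X := cluster (u @ \oo).

Definition omega_limit (X : topologicalType) (phi : hseq X) : set X :=
  [set x | exists kj : nat -> nat * nat,
     [/\ (forall i, hd phi (kj i)),
         (forall M : nat, exists I : nat, forall i, (I <= i)%N -> (M <= (kj i).1 + (kj i).2)%N) &
         (fun i => hv phi (kj i).1 (kj i).2) @ \oo --> x]].

(* ---------- step sizes (indexed from k = 1; h 0 is unused) ---------- *)
Section Steps.
Variable R : realType.

Definition admissible (h : nat -> R) : Prop :=
  [/\ (forall k, (1 <= k)%N -> 0 < h k),
      (fun k => h k) @ \oo --> (0 : R) &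
      (fun m => \sum_(1 <= k < m.+1) h k) @ \oo --> +oo].

Definition two_timescale_admissible (hs hf : nat -> R) : Prop :=
  [/\ admissible hs, admissible hf & (fun k => hs k / hf k) @ \oo --> (0 : R)].

Definition tau (h : nat -> R) (k : nat) : R := \sum_(0 <= i < k) h i.+1.
Definition mtime (h : nat -> R) (t : R) : nat :=
  xget 0%N [set k | tau h k <= t /\ forall k', tau h k' <= t -> (k' <= k)%N].

Definition asymptotic_simulation (X : normedModType R)
    (C' : set X) (F : X -> X) (D' : set X) (G : X -> X)
    (phi : hseq X) (h : nat -> R) : Prop :=
  [/\ hbounded phi, hcomplete phi, admissible h,
      (hcomplete_k phi ->
        exists f : nat -> X,
          [/\ exists B : R, forall k, `|f k| <= B,
              acc_pts (fun k => (hv phi k (jbar phi k), f k))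
                `<=` [set z | C' z.1 /\ z.2 = F z.1] &
              (forall T' : R, 0 < T' ->
                 forall eps : R, 0 < eps -> exists N0 : nat, forall m, (N0 <= m)%N ->
                   forall k, (m.+1 <= k)%N -> (k <= mtime h (tau h m + T'))%N ->
                     `| \sum_(m <= i < k)
                          h i.+1 *: ((h i.+1)^-1 *: (hv phi i.+1 (jbar phi i)
                                                     - hv phi i (jbar phi i)) - f i) |
                     <= eps)]) &
      (hcomplete_j phi ->
        acc_pts (fun j => (hv phi (kbar phi j) j, hv phi (kbar phi j) j.+1))
          `<=` [set z | D' z.1 /\ z.2 = G z.1])].
End Steps.

Section Prob.
Variables (R : realType) (d : measure_display) (Tw : measurableType d).

Definition iid_uniform (N : nat) (P : probability Tw R) (y : nat -> Tw -> 'I_N) : Prop :=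
  [/\ (forall k (B : set 'I_N), (1 <= k)%N -> measurable (y k @^-1` B)),
      (forall k (i : 'I_N), (1 <= k)%N -> P (y k @^-1` [set i]) = ((N%:R)^-1)%:E) &
      (forall (s : seq nat) (B : nat -> set 'I_N),
          uniq s -> all (fun k => (1 <= k)%N) s ->
          fine (P (\bigcap_(k in [set k | k \in s]) (y k @^-1` B k)))
          = \prod_(k <- s) fine (P (y k @^-1` B k)))].

Definition filt (N : nat) (y : nat -> Tw -> 'I_N) (k : nat) : set (set Tw) :=
  <<s [set A | exists i (B : set 'I_N), (1 <= i <= k)%N /\ A = y i @^-1` B] >>.

Definition setvalued_measurable (V : topologicalType) (G : set (set Tw))
   (S : Tw -> set V) : Prop :=
  forall O : set V, open O -> G [set w | S w `&` O !=set0].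

Definition solution_S (n N : nat) (Psis : 'I_N -> 'rV[R]_n -> R) (kappa T : R)
    (hs hf : nat -> R) (y : nat -> Tw -> 'I_N)
    (X : Tw -> hseq (stateHB R n * 'rV[R]_n)) : Prop :=
  (forall w, [/\ hcomplete (X w),
    (forall k j, hd (X w) (k, j) -> hd (X w) (k.+1, j) ->
       let z := hv (X w) k j in
       [/\ Cbig T z,
           (hv (X w) k.+1 j).1 = z.1 + hs k.+1 *: F_HB kappa T z.1 z.2 &
           (hv (X w) k.+1 j).2 = z.2 + hf k.+1 *: (grad (Psis (y k.+1 w)) z.1.1.1 - z.2)]) &
    (forall k j, hd (X w) (k, j) -> hd (X w) (k, j.+1) ->
       let z := hv (X w) k j in
       [/\ Dbig T z, (hv (X w) k j.+1).1 = G_HB z.1 & (hv (X w) k j.+1).2 = z.2])]) /\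
    (forall k, setvalued_measurable (filt y k)
        (fun w' => [set pz : R * (stateHB R n * 'rV[R]_n) |
                     exists j, hd (X w') (k, j) /\ pz = (j%:R, hv (X w') k j)])).
End Prob.

(* Main.v *)
(* Idea. The slow gradient variable q and the fast variable xi are unchanged by jumps, and
   T > 0 forbids two consecutive jumps, so both are sequences indexed by k alone.

   The error e = xi - grad Psi(q) obeys e_{k+1} = (1 - h_f) e_k + h_f U_{k+1} + O(h_s), where
   U is a bounded martingale difference on bounded paths and h_s = o(h_f). Coordinatewise,
   the noise part v satisfies E[v_{k+1}^(2(m+1)) | F_k] <= (1 - h_f/2) v_k^(2(m+1)) + C h_f^(m+2);
   with m + 1 >= rho the last term is summable and Doob's maximal inequality gives v -> 0
   almost surely. As F_k is generated by k letters of a finite alphabet, conditional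
   expectations are averages over the next letter of a word. Hence e -> 0.

   The flow increments are then exactly h_s F_HB(x_s, xi), so the Kushner-Clark sum vanishes.
   For the limit set, W = Psi(q) - min Psi + |p|^2/2 + a <grad Psi(q), p> with a small is a
   strict Lyapunov function: it decreases along flows at a rate bounded below away from
   {grad Psi(q) = 0, p = 0}, up to errors tending to 0, and at jumps up to such an error
   because <xi, p> >= 0 there. Jumps are at least T apart, which makes these errors harmless,
   so limsup W <= 0; and W <= 0 forces p = 0 and Psi(q) = min Psi. *)
Require Import Defs.
From mathcomp Require Import all_boot all_order all_algebra all_classical all_reals all_analysis.
From mathcomp Require Import ring lra zify.
Import numFieldNormedType.Exports.
Set Implicit Arguments. Unset Strict Implicit. Unset Printing Implicit Defensive.
Import Order.TTheory GRing.Theory Num.Theory.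
Local Open Scope classical_set_scope.
Local Open Scope ring_scope.

(** * Drift along a diverging clock, and hybrid time domains *)

Section Drift.
Variable R : realType.

Lemma cvg_pinfty_ge (t : nat -> R) (A : R) :
  t @ \oo --> +oo -> exists I : nat, forall i, (I <= i)%N -> A <= t i.
Proof.
move=> /cvgryPge /(_ A) [I _ HI]; exists I => i Ii; exact: HI.
Qed.

(** Above [e1] the quantity [b] loses [eta] per unit of the diverging clock [t], so the lower bound
    [lo] forces it down to [e1]; from there one step cannot pass [e2], and above [e1] it does not
    increase. *)
Lemma drift_eventually (b t : nat -> R) (I : nat) (eta lo e1 e2 : R) :
  0 < eta -> e1 <= e2 ->
  (forall i, (I <= i)%N -> t i <= t i.+1) -> t @ \oo --> +oo ->
  (forall i, (I <= i)%N -> lo <= b i) ->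
  (forall i, (I <= i)%N -> e1 < b i -> b i.+1 <= b i - eta * (t i.+1 - t i)) ->
  (forall i, (I <= i)%N -> b i <= e1 -> b i.+1 <= e2) ->
  exists I' : nat, forall i, (I' <= i)%N -> b i <= e2.
Proof.
move=> eta0 e12 tmono tinf blo bdec bin.
have [i1 Ii1 bi1] : exists2 i1, (I <= i1)%N & b i1 <= e1.
  apply: contrapT => none.
  have big i : (I <= i)%N -> e1 < b i.
    by move=> Ii; rewrite ltNge; apply/negP => bi; apply: none; exists i.
  have dec i : b (I + i)%N <= b I - eta * (t (I + i)%N - t I).
    elim: i => [|i IH]; first by rewrite addn0 subrr mulr0 subr0.
    rewrite addnS; apply: le_trans (bdec _ (leq_addr _ _) (big _ (leq_addr _ _))) _.
    by apply: le_trans (lerD IH (lexx _)) _; lra.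
  (* At this clock value the accumulated decrease would put [b] at [lo - 1] or lower. *)
  have [i0 Hi0] := cvg_pinfty_ge (t I + (b I - lo + 1) / eta) tinf.
  have := dec i0; have := blo (I + i0)%N (leq_addr _ _).
  have := Hi0 _ (leq_addl I i0).
  rewrite -(ler_pM2l eta0) mulrDr mulrCA mulfV ?gt_eqF// mulr1; lra.
exists i1; elim=> [|i IH]; first by rewrite leqn0 => /eqP <-; exact: le_trans bi1 e12.
rewrite leq_eqVlt => /predU1P[<-|]; first exact: le_trans bi1 e12.
rewrite ltnS => i1i; have Ii := leq_trans Ii1 i1i.
have [bi|bi] := leP (b i) e1; first exact: bin.
apply: le_trans (bdec _ Ii bi) _; have := IH i1i; have := tmono _ Ii.
by move=> h1 h2; nra.
Qed.

(** The clock is the partial sum of [h]. Once [rho <= e / 2], any value above [e] drops by at least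
    [h * e / 2], and convexity keeps values at most [e] there. *)
Lemma contraction_cvg0 (a h rho : nat -> R) (I : nat) :
  (forall i, (I <= i)%N -> 0 <= h i <= 1) ->
  (fun k => \sum_(0 <= i < k) h i) @ \oo --> +oo ->
  rho @ \oo --> (0 : R) ->
  (forall i, (I <= i)%N -> 0 <= a i) ->
  (forall i, (I <= i)%N -> a i.+1 <= (1 - h i) * a i + h i * rho i) ->
  a @ \oo --> (0 : R).
Proof.
move=> h01 hinf rho0 a0 arec; apply/cvgr0Pnorm_le => e e0.
have e20 : 0 < e / 2 by lra.
have [I1 _ HI1] := (cvgr0Pnorm_le rho).1 rho0 _ e20.
have [] := @drift_eventually a (fun k => \sum_(0 <= i < k) h i) (maxn I I1) (e / 2) 0 e e.
- by [].
- by [].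
- move=> i; rewrite geq_max => /andP[Ii _]; rewrite big_nat_recr//= lerDl.
  by case/andP: (h01 _ Ii).
- exact: hinf.
- by move=> i; rewrite geq_max => /andP[Ii _]; exact: a0.
- move=> i; rewrite geq_max => /andP[Ii Ii1] ai; rewrite big_nat_recr//=.
  have /andP[h0 h1] := h01 _ Ii; apply: le_trans (arec _ Ii) _.
  have /ler_normlP[_ r1] := HI1 _ Ii1; nra.
- move=> i; rewrite geq_max => /andP[Ii Ii1] ai.
  have /andP[h0 h1] := h01 _ Ii; apply: le_trans (arec _ Ii) _.
  have /ler_normlP[_ r1] := HI1 _ Ii1; nra.
move=> I2 H2; exists (maxn I I2) => // i /=; rewrite geq_max => /andP[Ii Ii2].
by rewrite ger0_norm ?a0// H2.
Qed.
End Drift.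

(** * Hybrid time domains as staircase paths *)

Section HybridDomain.

Lemma compact_hdom_mono E : compact_hdom E ->
  forall k j k' j', E (k, j) -> E (k', j') -> (k < k')%N -> (j <= j')%N.
Proof.
move=> [J [kk [kk0 kkmono ->]]] k j k' j' [/= jJ /andP[kj kj1]] [/= j'J /andP[kj' kj1']] kk'.
rewrite leqNgt; apply/negP => j'j.
have mono d : (j'.+1 + d < J)%N -> (kk j'.+1 <= kk (j'.+1 + d))%N.
  elim: d => [|d IH]; rewrite ?addn0// addnS => dJ.
  by apply: leq_trans (IH (ltnW dJ)) (kkmono _ _); exact: ltnW.
have := mono (j - j'.+1)%N; rewrite subnKC// => /(_ jJ); lia.
Qed.

(** A point to the right of the left end [kk j] of its level has a predecessor in [k]; at that left
    end, which is the right end of level [j - 1], it has one in [j]. *)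
Lemma compact_hdom_pred E : compact_hdom E ->
  forall k j, E (k, j) -> (0 < k + j)%N ->
  (exists2 k0, k = k0.+1 & E (k0, j)) \/ (exists2 j0, j = j0.+1 & E (k, j0)).
Proof.
move=> [J [kk [kk0 kkmono ->]]] k j [/= jJ /andP[kj kj1]] kj0.
have [ltk|gek] := ltnP (kk j) k.
  by left; exists k.-1; [lia|split => //=; lia].
right; case: j => [|j] in jJ kj kj1 kj0 gek *; first by lia.
exists j => //; split => /=; first exact: ltnW.
by rewrite gek andbT (leq_trans (kkmono _ (ltnW jJ)))//.
Qed.

Lemma hdom_common E (x x' : nat * nat) : hdom E -> E x -> E x' ->
  exists F, [/\ compact_hdom F, F `<=` E, F x & F x'].
Proof.
move=> [Es [cE mE ->]] [i _ Ei] [i' _ Ei'].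
have mono m d : Es m `<=` Es (m + d)%N.
  by elim: d => [|d IH]; rewrite ?addn0// addnS; apply: subset_trans IH (mE _).
exists (Es (i + i')%N); split => //; first exact: bigcup_sup.
- exact: mono.
- by rewrite addnC; exact: mono.
Qed.

Lemma hdom_mono E : hdom E ->
  forall k j k' j', E (k, j) -> E (k', j') -> (k < k')%N -> (j <= j')%N.
Proof.
move=> hE k j k' j' Ekj Ekj'; have [F [cF _ F1 F2]] := hdom_common hE Ekj Ekj'.
exact: compact_hdom_mono F1 F2.
Qed.

Lemma hdom_pred E : hdom E -> forall k j, E (k, j) -> (0 < k + j)%N ->
  (exists2 k0, k = k0.+1 & E (k0, j)) \/ (exists2 j0, j = j0.+1 & E (k, j0)).
Proof.
move=> hE k j Ekj; have [F [cF FE F1 _]] := hdom_common hE Ekj Ekj.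
by move=> /(compact_hdom_pred cF F1) [[k0 ? /FE]|[j0 ? /FE]]; [left; exists k0|right; exists j0].
Qed.

Lemma hdom_uniq E : hdom E -> forall k j k' j', E (k, j) -> E (k', j') ->
  (k + j = k' + j')%N -> (k, j) = (k', j').
Proof.
move=> hE k j k' j' E1 E2 s.
have [lt|lt|eq] := ltngtP k k'.
- by have := hdom_mono hE E1 E2 lt; lia.
- by have := hdom_mono hE E2 E1 lt; lia.
- by congr pair => //; lia.
Qed.

(** Each antidiagonal [k + j = i] meets the domain in exactly one point: predecessors lead down to
    it from the far points that completeness supplies, and monotonicity makes it unique. *)
Lemma hcomplete_path (V : Type) (phi : hseq V) : hcomplete phi ->
  exists pi : nat -> nat * nat,
    [/\ forall i, hd phi (pi i),
        pi 0%N = (0%N, 0%N),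
        forall k j, hd phi (k, j) -> pi (k + j)%N = (k, j) &
        forall i, pi i.+1 = ((pi i).1.+1, (pi i).2) \/
                  pi i.+1 = ((pi i).1, (pi i).2.+1)].
Proof.
move=> cphi; have hE := hdP phi.
have down d : forall k j i, hd phi (k, j) -> (k + j = i + d)%N ->
    exists x, hd phi x /\ (x.1 + x.2 = i)%N.
  elim: d => [|d IH] k j i Ekj kji; first by exists (k, j); rewrite /= kji addn0.
  have [|[k0 ek E0]|[j0 ej E0]] := hdom_pred hE Ekj; first by lia.
  - by apply: IH E0 _; lia.
  - by apply: IH E0 _; lia.
have ex i : exists x, hd phi x /\ (x.1 + x.2 = i)%N.
  apply: contrapT => none; apply: cphi; exists i => k j Ekj; rewrite leqNgt.
  apply/negP => ikj; apply: none; apply: (down (k + j - i)%N _ _ _ Ekj); lia.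
have [pi Hpi] := choice ex.
have piE k j : hd phi (k, j) -> pi (k + j)%N = (k, j).
  move=> Ekj; have [] := Hpi (k + j)%N; case: (pi _) => k' j' E' s.
  exact: hdom_uniq hE _ _ _ _ E' Ekj s.
exists pi; split => // [i||i].
- by have [] := Hpi i.
- by have [] := Hpi 0%N; case: (pi 0%N) => k j _ /= s; congr pair; lia.
- have [] := Hpi i.+1; case E1: (pi i.+1) => [k j] Ekj /= s.
  have [|[k0 ek E0]|[j0 ej E0]] := hdom_pred hE Ekj; first by lia.
  + by left; have := piE _ _ E0; rewrite (_ : (k0 + j)%N = i) ?ek; [move=> ->|lia].
  + by right; have := piE _ _ E0; rewrite (_ : (k + j0)%N = i) ?ej; [move=> ->|lia].
Qed.

End HybridDomain.

(** * Stochastic filtering of bounded noise *)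

Section Moment.
Variable R : realType.

(** Induction multiplies the remainder by [x + z]; the squared constant is large enough because
    [N + N ^ 2 <= (N + 1) ^ 2]. *)
Lemma expr_taylor2 (x z : R) (n : nat) :
  `|(x + z) ^+ n.+2 - x ^+ n.+2 - n.+2%:R * x ^+ n.+1 * z|
    <= n.+2%:R ^+ 2 * (`|x| + `|z|) ^+ n * z ^+ 2.
Proof.
elim: n => [|n IH].
  rewrite expr0 mulr1 (_ : _ - _ = z ^+ 2); last by ring.
  by rewrite ger0_norm ?sqr_ge0//; have := sqr_ge0 z; nra.
set r := (_ - _ - _) in IH.
have -> : (x + z) ^+ n.+3 - x ^+ n.+3 - n.+3%:R * x ^+ n.+2 * z =
    n.+2%:R * x ^+ n.+1 * z ^+ 2 + (x + z) * r.
  by rewrite /r !exprS -(@natr1 _ n.+2); ring.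
set u := `|x| + `|z|; have u0 : 0 <= u by rewrite addr_ge0.
have xu : `|x| ^+ n.+1 <= u ^+ n.+1 by rewrite lerXn2r ?nnegrE// lerDl.
have xzu : `|x + z| <= u by exact: ler_normD.
have z2 := sqr_ge0 z.
apply: (@le_trans _ _ (n.+2%:R * u ^+ n.+1 * z ^+ 2 + u * (n.+2%:R ^+ 2 * u ^+ n * z ^+ 2))).
  apply: le_trans (ler_normD _ _) _; apply: lerD.
    rewrite normrM (ger0_norm z2) ler_wpM2r// normrM normrX normr_nat.
    by rewrite ler_wpM2l.
  by rewrite normrM; apply: ler_pM.
rewrite (exprS u); set t := u * u ^+ n * z ^+ 2.
have t0 : 0 <= t by rewrite mulr_ge0// mulr_ge0// exprn_ge0.
rewrite (_ : _ + _ = (n.+2%:R + n.+2%:R ^+ 2) * t); last by rewrite /t; ring.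
rewrite (_ : n.+3%:R ^+ 2 * _ * _ = n.+3%:R ^+ 2 * t); last by rewrite /t; ring.
rewrite ler_wpM2r// -(@natr1 _ n.+2); have : (0 : R) <= n.+2%:R by [].
set N := n.+2%:R; nra.
Qed.

(* Young's inequality: the second-order term is absorbed by the contraction
   when h <= delta x^2, and is of order h^(m+2) otherwise. *)
Lemma second_order_absorb (K B : R) (m : nat) : 0 <= K -> exists2 C : R, 0 <= C &
  forall h x z : R, 0 < h <= 1 -> `|z| <= h * B ->
  K * (2 * x ^+ 2 + 2 * z ^+ 2) ^+ m * z ^+ 2 <= h / 2 * (x ^+ 2) ^+ m.+1 + C * h ^+ m.+2.
Proof.
move=> K0; set b := B ^+ 2; have b0 : 0 <= b by exact: sqr_ge0.
set K4 := K * 4 ^+ m; have K40 : 0 <= K4 by rewrite mulr_ge0// exprn_ge0.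
(* [dl] is small enough for both [dl * b <= 1] and [K4 * b * dl <= 1 / 2]. *)
set dl := ((1 + b) * (1 + 2 * K4))^-1.
have p0 : 0 < (1 + b) * (1 + 2 * K4) by nra.
have dl0 : 0 < dl by rewrite invr_gt0.
have dlE : dl * ((1 + b) * (1 + 2 * K4)) = 1 by rewrite /dl mulVf ?gt_eqF.
have dlb : dl * b <= 1.
  rewrite -dlE ler_pM2l//; nra.
have dlK : K4 * b * dl <= 1 / 2.
  have : dl * (b * (2 * K4)) <= 1 by rewrite -dlE ler_pM2l//; nra.
  lra.
have di0 : 0 < dl^-1 by rewrite invr_gt0.
exists (K * (2 / dl + 2 * b) ^+ m * b).
  by rewrite mulr_ge0// mulr_ge0// exprn_ge0//; nra.
move=> h x z /andP[h0 h1] zh; set s := x ^+ 2; have s0 : 0 <= s by exact: sqr_ge0.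
have z2 : z ^+ 2 <= h ^+ 2 * b.
  rewrite -exprMn -(real_normK (num_real z)) lerXn2r ?nnegrE//.
  exact: le_trans zh.
have z20 : 0 <= z ^+ 2 by exact: sqr_ge0.
have Ch : 0 <= h ^+ m.+2 by rewrite exprn_ge0// ltW.
have zb : z ^+ 2 <= h * b by apply: le_trans z2 _; rewrite ler_wpM2r// expr2; nra.
(* For [h <= dl * s] one has [z ^ 2 <= s], and one of the two factors [h] is exchanged for [dl * s];
   otherwise [s] is of order [h] and every factor becomes a power of [h]. *)
have [hs|hs] := leP h (dl * s).
  have zs : z ^+ 2 <= s.
    apply: le_trans zb _.
    have : h * b <= dl * s * b by rewrite ler_wpM2r.
    have : dl * b * s <= 1 * s by rewrite ler_wpM2r.
    lra.
  apply: (@le_trans _ _ (h / 2 * s ^+ m.+1)); last first.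
    rewrite lerDl mulr_ge0// mulr_ge0// mulr_ge0// exprn_ge0//; nra.
  apply: (@le_trans _ _ (K * (4 * s) ^+ m * (h ^+ 2 * b))).
    apply: ler_pM => //; first by rewrite mulr_ge0// exprn_ge0//; nra.
    rewrite ler_wpM2l// lerXn2r ?nnegrE//; nra.
  rewrite exprMn (exprS s) (_ : K * _ * _ = h * (K4 * b * h * s ^+ m)); last by rewrite /K4; ring.
  rewrite -(mulrA h) ler_pM2l//.
  apply: (@le_trans _ _ (K4 * b * (dl * s) * s ^+ m)).
    apply: ler_wpM2r; first exact: exprn_ge0.
    by apply: ler_wpM2l => //; rewrite mulr_ge0.
  rewrite (_ : K4 * b * (dl * s) * _ = K4 * b * dl * (s * s ^+ m)); last by ring.
  have ss0 : 0 <= s * s ^+ m by rewrite mulr_ge0// exprn_ge0.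
  by apply: le_trans (ler_wpM2r ss0 dlK) _; lra.
have sh : s <= h / dl.
  by rewrite ler_pdivlMr// mulrC ltW.
apply: (@le_trans _ _ (K * (2 / dl + 2 * b) ^+ m * b * h ^+ m.+2)); last first.
  rewrite lerDr; apply: mulr_ge0; last exact: exprn_ge0.
  lra.
apply: (@le_trans _ _ (K * (h * (2 / dl + 2 * b)) ^+ m * (h ^+ 2 * b))).
  apply: ler_pM => //; first by rewrite mulr_ge0// exprn_ge0//; lra.
  have le2 : 2 * s + 2 * z ^+ 2 <= h * (2 / dl + 2 * b).
    by rewrite (_ : h * (2 / dl + 2 * b) = 2 * (h / dl) + 2 * (h * b)); [lra|ring].
  have ge2 : 0 <= 2 * s + 2 * z ^+ 2 by lra.
  by rewrite ler_wpM2l// lerXn2r ?nnegrE//; exact: le_trans le2.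
by rewrite le_eqVlt; apply/orP; left; apply/eqP; rewrite exprMn !(exprS h); ring.
Qed.

(** Expand around [x = (1 - h) v]: the linear term vanishes on summing the mean-zero [g], and the
    second-order term consumes half of the contraction gained from [x]. *)
Lemma moment_step (N : nat) (B : R) (m : nat) : exists2 C : R, 0 <= C &
  forall (h v : R) (g : 'I_N -> R), 0 < h <= 1 ->
  (forall c, `|g c| <= B) -> \sum_c g c = 0 ->
  \sum_c ((1 - h) * v + h * g c) ^+ (m.+1).*2 <=
    N%:R * ((1 - h / 2) * v ^+ (m.+1).*2 + C * h ^+ m.+2).
Proof.
have [C C0 HC] := @second_order_absorb ((m.+1).*2%:R ^+ 2) B m (sqr_ge0 _).
exists C => // h v g h01 gB gsum; have /andP[h0 h1] := h01.
set x := (1 - h) * v; set e := (m.+1).*2.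
apply: (@le_trans _ _ (\sum_(c < N) (((1 - h / 2) * v ^+ e + C * h ^+ m.+2) + (e%:R * x ^+ (m.*2).+1 * h) * g c))).
  apply: ler_sum => c _; set z := h * g c.
  have zB : `|z| <= h * B by rewrite normrM gtr0_norm// ler_pM2l.
  have /ler_normlP[_ T2] := expr_taylor2 x z (m.*2).
  have A2 := HC h x z h01 zB.
  have ve0 : 0 <= v ^+ e by rewrite -[e]muln2 mulnC exprM exprn_ge0 ?sqr_ge0.
  have xe : x ^+ e <= (1 - h) * v ^+ e.
    rewrite /x exprMn ler_wpM2r// /e doubleS exprS.
    have : (1 - h) ^+ (m.*2).+1 <= 1 by rewrite exprn_ile1//; lra.
    by move=> ?; nra.
  have xe' : (x ^+ 2) ^+ m.+1 = x ^+ e by rewrite -exprM /e -muln2 mulnC.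
  have pw : (`|x| + `|z|) ^+ m.*2 <= (2 * x ^+ 2 + 2 * z ^+ 2) ^+ m.
    rewrite -mul2n exprM lerXn2r ?nnegrE//.
    - by have := sqr_ge0 x; have := sqr_ge0 z; lra.
    - rewrite -(real_normK (num_real x)) -(real_normK (num_real z)).
      by have := sqr_ge0 (`|x| - `|z|); lra.
  have pw2 : e%:R ^+ 2 * (`|x| + `|z|) ^+ m.*2 * z ^+ 2 <=
      e%:R ^+ 2 * (2 * x ^+ 2 + 2 * z ^+ 2) ^+ m * z ^+ 2.
    by rewrite ler_wpM2r ?sqr_ge0// ler_wpM2l// sqr_ge0.
  have hxe : h / 2 * x ^+ e <= h / 2 * v ^+ e.
    rewrite ler_wpM2l//; [lra|nra].
  move: T2 A2; rewrite xe' /e -doubleS -/e; rewrite /z in pw2 *; lra.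
by rewrite big_split/= sumr_const card_ord -mulr_sumr gsum mulr0 addr0 mulr_natl.
Qed.
End Moment.

(** * Words of sampled letters and a maximal inequality *)

Section Words.
Variables (R : realType) (d : measure_display) (Tw : measurableType d).
Variables (P : probability Tw R) (N : nat) (y : nat -> Tw -> 'I_N).
Hypothesis N0 : (0 < N)%N.
Hypothesis iid : iid_uniform P y.

(* Latest letter first. *)
Fixpoint word (k : nat) (w : Tw) : seq 'I_N :=
  if k is k'.+1 then y k'.+1 w :: word k' w else [::].

Lemma size_word k w : size (word k w) = k.
Proof. by elim: k => //= k ->. Qed.

Lemma measurable_letter k c : (1 <= k)%N -> measurable [set w | y k w = c].
Proof. by move=> k1; case: iid => + _ _ => /(_ k [set c] k1). Qed.

(** [Q] is arbitrary: only finitely many words have length [k], so the event splits into finitely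
    many cases by the latest letter. *)
Lemma measurable_word k (Q : set (seq 'I_N)) : measurable [set w | Q (word k w)].
Proof.
elim: k Q => [|k IH] Q /=.
  have [q|q] := pselect (Q [::]).
    rewrite (_ : mkset _ = setT); first exact: measurableT.
    by apply/seteqP; split.
  rewrite (_ : mkset _ = set0); first exact: measurable0.
  by apply/seteqP; split.
rewrite (_ : mkset _ =
    \bigcup_(c in [set: 'I_N]) ([set w | y k.+1 w = c] `&` [set w | Q (c :: word k w)])).
  apply: fin_bigcup_measurable => // c _; apply: measurableI.
    exact: measurable_letter.
  exact: (IH (fun s => Q (c :: s))).
apply/seteqP; split => w /=; first by move=> Qw; exists (y k.+1 w).
by move=> [c _ [/= -> ]].
Qed.

Lemma probability_word (s : seq 'I_N) :
  P [set w | word (size s) w = s] = ((N%:R^-1) ^+ size s)%:E.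
Proof.
(* The latest letter comes first, so letter [k] sits at position [n - k]; for [1 <= k <= n] this is
   below [n], and the default [c] of [nth] is not returned. *)
set n := size s; pose B k := [set c | nth c s (n - k) = c].
have -> : [set w | word n w = s] =
    \bigcap_(k in [set k | k \in iota 1 n]) (y k @^-1` B k).
  have wE k w c0 : (1 <= k <= n)%N -> nth c0 (word n w) (n - k) = y k w.
    elim: n {B} k => [|m IH] k /=; first lia.
    have [->|km] := eqVneq k m.+1; first by rewrite subnn.
    by move=> kk; rewrite subSn/= ?IH//; lia.
  apply/seteqP; split => [w /= ws k|w Bw].
    rewrite /= mem_iota => kn; rewrite /B/= -[in LHS]ws wE//; lia.
  pose c0 := Ordinal N0.
  apply: (@eq_from_nth _ c0); rewrite size_word// => i iN.
  have kn : (1 <= n - i <= n)%N by lia.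
  have nK : (n - (n - i) = i)%N by lia.
  have /Bw : [set k | k \in iota 1 n] (n - i)%N by rewrite /= mem_iota; lia.
  have := wE _ w c0 kn; rewrite /B/= nK => -> <-.
  exact: set_nth_default.
have [ym yP yI] := iid.
have fin A : P A \is a fin_num -> P A = (fine (P A))%:E by move=> ?; rewrite fineK.
rewrite fin; last first.
  apply: fin_num_measure; apply: bigcap_measurableType => k /=.
  by rewrite mem_iota => kn; apply: ym; lia.
rewrite yI ?iota_uniq//; last by apply/allP => k; rewrite mem_iota; lia.
congr (_%:E); rewrite (eq_big_seq (fun=> (N%:R)^-1)).
  by rewrite big_const_seq count_predT size_iota iter_mulr_1.
move=> k; rewrite mem_iota => kn.
rewrite (_ : y k @^-1` B k = y k @^-1` [set nth (Ordinal N0) s (n - k)]); last first.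
  apply/seteqP; split => w; rewrite /B/= => e.
    by rewrite -e; apply: set_nth_default; rewrite -/n; lia.
  by rewrite [RHS]e; apply: set_nth_default; rewrite -/n; lia.
by rewrite yP//; lia.
Qed.

(** A union bound over the next letter; intersecting with an arbitrary [H] lets later inductions
    carry an event that depends on future letters. *)
Lemma probability_le_letter (s : seq 'I_N) (H : set Tw) : measurable H ->
  (P ([set w | word (size s) w = s] `&` H) <=
    \sum_c P ([set w | word (size s).+1 w = c :: s] `&` H))%E.
Proof.
move=> mH.
have mI k t : measurable ([set w | word k w = t] `&` H).
  by apply: measurableI => //; exact: (measurable_word k [set t]).
pose F c := [set w | word (size s).+1 w = c :: s] `&` H.
have sub r : (P (\big[setU/set0]_(c <- r) F c) <= \sum_(c <- r) P (F c))%E.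
  elim: r => [|c r IH]; first by rewrite !big_nil measure0.
  rewrite !big_cons; apply: le_trans (measureU2 _ _ _) _ => //.
  - exact: mI.
  - by apply: bigsetU_measurable => c' _; exact: mI.
  - exact: leeD2l.
apply: le_trans (sub (index_enum 'I_N)); apply: le_measure; rewrite ?inE.
- exact: mI.
- by apply: bigsetU_measurable => c _; exact: mI.
- rewrite -bigcup_seq => w [/= ws Hw]; exists (y (size s).+1 w) => /=.
    exact: mem_index_enum.
  by split => //=; rewrite ws.
Qed.

(** Expectation over uniform words of length [k]. The latest letter is averaged out first, so the
    inner average is the conditional expectation given the earlier letters. *)
Fixpoint word_mean (k : nat) (phi : seq 'I_N -> R) : R :=
  if k is k'.+1 then word_mean k' (fun s => N%:R^-1 * \sum_c phi (c :: s)) else phi [::].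

Lemma word_mean_le k phi psi : (forall s, size s = k -> phi s <= psi s) ->
  word_mean k phi <= word_mean k psi.
Proof.
elim: k phi psi => [|k IH] phi psi H /=; first exact: H.
apply: IH => s sk; rewrite ler_wpM2l ?invr_ge0//.
by apply: ler_sum => c _; apply: H; rewrite /= sk.
Qed.

Lemma word_mean_affine k phi a b :
  word_mean k (fun s => a * phi s + b) = a * word_mean k phi + b.
Proof.
elim: k phi => [//|k IH] phi /=; rewrite -IH; congr word_mean; apply/funext => s.
rewrite big_split/= -mulr_sumr sumr_const card_ord mulrDr mulrCA; congr (_ + _).
by rewrite -[b *+ N]mulr_natl mulrA mulVf ?mul1r// pnatr_eq0 -lt0n.
Qed.

Lemma probability_word_mean k (H : set Tw) (phi : seq 'I_N -> R) : measurable H ->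
  (forall s, size s = k ->
    (P ([set w | word k w = s] `&` H) <= (N%:R^-1 ^+ k * phi s)%:E)%E) ->
  (P H <= (word_mean k phi)%:E)%E.
Proof.
move=> mH; elim: k phi => [|k IH] phi Hphi /=.
  have := Hphi [::] erefl; rewrite expr0 mul1r; apply: le_trans.
  rewrite le_eqVlt; apply/orP; left; apply/eqP; congr (P _).
  by apply/seteqP; split => w //= -[].
apply: IH => s sk; rewrite -{1}sk; apply: le_trans (probability_le_letter _ mH) _.
rewrite mulrA -exprSr mulr_sumr -sumEFin; apply: lee_sum => c _.
by rewrite sk; apply: Hphi; rewrite /= sk.
Qed.

(** Doob's maximal inequality started at the word [s], by induction on the horizon. If [U s] already
    reaches [lam], the probability of the word suffices, since [U s / lam >= 1]; otherwise the
    crossing happens after one of the next letters, and the supermartingale inequality averages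
    their bounds. *)
Lemma word_maximal (K0 : nat) (U : seq 'I_N -> R) (lam : R) : 0 < lam ->
  (forall s, (K0 <= size s)%N -> 0 <= U s) ->
  (forall s, (K0 <= size s)%N -> N%:R^-1 * \sum_c U (c :: s) <= U s) ->
  forall n s, (K0 <= size s)%N ->
  (P ([set w | word (size s) w = s] `&`
     [set w | exists2 i, (i <= n)%N & (lam <= U (word (size s + i) w))%R]) <=
   (N%:R^-1 ^+ size s * (U s / lam))%:E)%E.
Proof.
move=> lam0 U0 US n s.
have mE k m : measurable [set w | exists2 i, (i <= m)%N & (lam <= U (word (k + i) w))%R].
  rewrite (_ : mkset _ = \bigcup_(i in `I_m.+1) [set w | [set s | lam <= U s] (word (k + i) w)]).
    by apply: fin_bigcup_measurable => // i _; exact: measurable_word.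
  by apply/seteqP; split => w [i im Ui]; exists i.
have mW t k : measurable [set w | word k w = t] by exact: (measurable_word k [set t]).
have big t m : lam <= U t -> (P ([set w | word (size t) w = t] `&`
     [set w | exists2 i, (i <= m)%N & (lam <= U (word (size t + i) w))%R]) <=
   (N%:R^-1 ^+ size t * (U t / lam))%:E)%E.
  move=> lU; apply: (@le_trans _ _ (N%:R^-1 ^+ size t)%:E).
    rewrite -probability_word; apply: le_measure; rewrite ?inE.
    - by apply: measurableI; [exact: mW|exact: mE].
    - exact: mW.
    - by move=> w [].
  by rewrite lee_fin ler_peMr ?exprn_ge0 ?invr_ge0// ler_pdivlMr ?mul1r.
elim: n s => [|n IH] s sK.
  have [lU|lU] := leP lam (U s); first exact: big.
  rewrite (_ : _ `&` _ = set0).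
    by rewrite measure0 lee_fin mulr_ge0 ?exprn_ge0 ?invr_ge0// divr_ge0 ?U0// ltW.
  apply/seteqP; split => w //= [ws [i]]; rewrite leqn0 => /eqP ->.
  by rewrite addn0 ws leNgt lU.
have [lU|lU] := leP lam (U s); first exact: big.
apply: le_trans (probability_le_letter _ _) _; first exact: mE.
apply: (@le_trans _ _ (\sum_(c < N) (N%:R^-1 ^+ (size s).+1 * (U (c :: s) / lam))%:E)%E).
  apply: lee_sum => c _.
  apply: le_trans (IH (c :: s) (leqW sK)); apply: le_measure; rewrite ?inE.
  - by apply: measurableI => //; exact: mE.
  - by apply: measurableI => //; exact: mE.
  move=> w /= [ws [[|i] iN Ui]].
    move: ws Ui => [_ ws]; rewrite addn0 ws => Ui.
    by move: lU; rewrite ltNge Ui.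
  by split => //; exists i => //; move: Ui; rewrite ?addnS ?addSn.
rewrite sumEFin lee_fin -mulr_sumr exprSr -mulrA ler_wpM2l ?exprn_ge0 ?invr_ge0//.
by rewrite -mulr_suml mulrA ler_wpM2r ?invr_ge0 ?(ltW lam0)// US.
Qed.
End Words.

Lemma tau_cvg_pinfty (R : realType) (h : nat -> R) : admissible h -> tau h @ \oo --> +oo.
Proof.
move=> [_ _ hinf]; rewrite (_ : tau h = (fun m => \sum_(1 <= k < m.+1) h k))//.
by apply/funext => k; rewrite big_add1.
Qed.

Section NoiseConvergence.
Variables (R : realType) (d : measure_display) (Tw : measurableType d).
Variables (P : probability Tw R) (N : nat) (y : nat -> Tw -> 'I_N).

(* The even moment v^(2(m+1)), plus the tail of the step-size series, is a nonnegative
   supermartingale with vanishing mean; the maximal inequality makes v vanish. *)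
Lemma noise_filter_cvg0 (h : nat -> R) (rho l B : R) (v : seq 'I_N -> R)
    (g : 'I_N -> seq 'I_N -> R) :
  (0 < N)%N -> iid_uniform P y -> admissible h ->
  series (fun k => h k.+1 `^ (1 + rho)) @ \oo --> l ->
  (forall c s, `|g c s| <= B) -> (forall s, \sum_c g c s = 0) ->
  (forall c s, v (c :: s) = (1 - h (size s).+1) * v s + h (size s).+1 * g c s) ->
  P.-negligible [set w | ~ ((fun k => v (word y k w)) @ \oo --> (0 : R))].
Proof.
move=> N0 iid hadm hl gB gsum vrec.
have [hpos h0 _] := hadm.
(* With this [m], [rho < m + 1], so [h ^ (m + 2) <= h ^ (1 + rho)] once [h <= 1]. *)
set m := Num.truncn `|rho|.
have [C C0 HC] := moment_step N B m.
have Nr0 : (N%:R : R) != 0 by rewrite pnatr_eq0 -lt0n.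
have [K0 HK0] : exists K0 : nat, forall k, (K0 <= k)%N -> h k <= 1.
  have [K _ HK] := (cvgr0Pnorm_le h).1 h0 1 ltr01.
  by exists K => k Kk; apply: le_trans (ler_norm _) _; exact: HK.
have h01 k : (K0 <= k)%N -> 0 < h k.+1 <= 1.
  by move=> Kk; rewrite hpos// HK0// leqW.
set e := (m.+1).*2.
pose phi (s : seq 'I_N) := v s ^+ e.
have phi0 s : 0 <= phi s by rewrite /phi /e -mul2n exprM exprn_ge0 ?sqr_ge0.
have phistep s : (K0 <= size s)%N -> N%:R^-1 * \sum_c phi (c :: s) <=
    (1 - h (size s).+1 / 2) * phi s + C * h (size s).+1 ^+ m.+2.
  move=> sK; rewrite -(ler_pM2l (_ : 0 < N%:R)) ?ltr0n// mulrA mulfV// mul1r.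
  rewrite (eq_bigr (fun c => ((1 - h (size s).+1) * v s + h (size s).+1 * g c s) ^+ e)).
    by apply: HC => //; exact: h01.
  by move=> c _; rewrite /phi vrec.
set S := series _ in hl.
have Smono : nondecreasing_seq S.
  by apply/nondecreasing_seqP => k; rewrite /S seriesEnat/= big_nat_recr//= lerDl powR_ge0.
have Sl k : S k <= l.
  rewrite -(cvg_lim _ hl)//; apply: nondecreasing_cvgn_le => //.
  by apply/cvg_ex; exists l.
have powle k : (K0 <= k)%N -> h k.+1 ^+ m.+2 <= h k.+1 `^ (1 + rho).
  move=> Kk; have /andP[hk0 hk1] := h01 _ Kk; rewrite -powR_mulrn; last exact: ltW.
  apply: (ger_powR (h01 _ Kk)).
  rewrite -natr1 (addrC _ 1) lerD2l; apply: le_trans (ler_norm _) _.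
  by rewrite ltW// /m truncnS_gt.
have SS k : S k.+1 = S k + h k.+1 `^ (1 + rho).
  by rewrite /S seriesEnat/= big_nat_recr.
(* The remaining tail [l - S] pays in advance for all later terms [C * h ^+ m.+2]. *)
pose U s := phi s + C * (l - S (size s)).
have U0 s : (K0 <= size s)%N -> 0 <= U s.
  by move=> _; rewrite addr_ge0// mulr_ge0// subr_ge0.
have US s : (K0 <= size s)%N -> N%:R^-1 * \sum_c U (c :: s) <= U s.
  move=> sK; rewrite /U big_split/= sumr_const card_ord mulrDr.
  rewrite -[(C * _) *+ N]mulr_natl (mulrA N%:R^-1 N%:R) mulVf// mul1r SS.
  have := phistep s sK; have /andP[hk0 _] := h01 _ sK.
  have := powle _ sK; move=> pl.
  have : C * h (size s).+1 ^+ m.+2 <= C * h (size s).+1 `^ (1 + rho) by rewrite ler_wpM2l.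
  have : 0 <= h (size s).+1 * phi s by rewrite mulr_ge0// ltW.
  lra.
(* The mean of [U] at time [k] is [a k + C * (l - S k)], so the maximal inequality calls for [a] to
   vanish. *)
pose a k := word_mean k phi.
have a0 k : 0 <= a k.
  apply: (@le_trans _ _ (word_mean k (fun s => 0 * phi s + 0))).
    by rewrite word_mean_affine// mul0r addr0.
  by apply: word_mean_le => s _; rewrite mul0r addr0.
have arec k : (K0 <= k)%N ->
    a k.+1 <= (1 - h k.+1 / 2) * a k + h k.+1 / 2 * (2 * C * h k.+1 ^+ m.+1).
  move=> Kk; apply: le_trans (@word_mean_le _ _ k (fun s => N%:R^-1 * \sum_c phi (c :: s)) (fun s =>
     (1 - h k.+1 / 2) * phi s + C * h k.+1 ^+ m.+2) _) _.
    by move=> s sk; have := phistep s; rewrite sk => /(_ Kk).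
  rewrite word_mean_affine// lerD2l le_eqVlt; apply/orP; left; apply/eqP.
  by rewrite (exprS _ m.+1); field.
have a_cvg : a @ \oo --> (0 : R).
  apply: (@contraction_cvg0 _ a (fun k => h k.+1 / 2) (fun k => 2 * C * h k.+1 ^+ m.+1) K0).
  - by move=> i /h01/andP[? ?]; lra.
  - have /cvgryPge tinf := tau_cvg_pinfty hadm; apply/cvgryPge => A.
    by apply: filterS (tinf (A * 2)) => k; rewrite -mulr_suml -/(tau h k); lra.
  - have h0' : (fun k => h k.+1) @ \oo --> (0 : R) by rewrite (cvg_shiftS h).
    rewrite -[X in _ --> X](_ : 2 * C * 0 ^+ m.+1 = 0); last by rewrite expr0n/= mulr0.
    apply: cvgM; first exact: cvg_cst.
    apply: (continuous_cvg _ (f := fun k => h k.+1) (h := fun x : R => x ^+ m.+1) (a := 0)).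
      exact: exprn_continuous.
    exact: h0'.
  - by move=> i _; exact: a0.
  - by move=> i /arec.
(* [H lam k n] is the crossing of level [lam] between times [k] and [k + n]; [Z lam], below,
   collects the paths that cross it arbitrarily late. *)
pose H lam k n := [set w | exists2 i, (i <= n)%N & lam <= U (word y (k + i) w)].
have mH lam k n : measurable (H lam k n).
  rewrite (_ : H lam k n = \bigcup_(i in `I_n.+1) [set w | [set s | lam <= U s] (word y (k + i) w)]).
    apply: fin_bigcup_measurable => // i _; exact: (measurable_word iid).
  by apply/seteqP; split => w [i im Ui]; exists i.
have PH lam k n : 0 < lam -> (K0 <= k)%N ->
    (P (H lam k n) <= ((a k + C * (l - S k)) / lam)%:E)%E.
  move=> lam0 Kk.
  have -> : (a k + C * (l - S k)) / lam = word_mean k (fun s => (lam^-1 * phi s + C * (l - S k) / lam)).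
    by rewrite word_mean_affine// mulrDl (mulrC (a k)).
  apply: (probability_word_mean iid) => // s sk.
  have := word_maximal N0 iid lam0 U0 US n (s := s); rewrite sk => /(_ Kk).
  rewrite (_ : U s / lam = lam^-1 * phi s + C * (l - S k) / lam) ?sk//.
  by rewrite /U sk mulrDl mulrC.
have bound_cvg lam : (fun k => (a k + C * (l - S k)) / lam) @ \oo --> (0 : R).
  rewrite -[X in _ --> X](_ : (0 + C * (l - l)) / lam = 0); last first.
    by rewrite subrr mulr0 addr0 mul0r.
  apply: cvgM; last exact: cvg_cst.
  apply: cvgD; first exact: a_cvg.
  by apply: cvgM; [exact: cvg_cst|apply: cvgB]; [exact: cvg_cst|exact: hl].
pose Z lam := \bigcap_k \bigcup_n H lam (K0 + k)%N n.
have mU lam k : measurable (\bigcup_n H lam k n) by exact: bigcupT_measurable.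
have mZ lam : measurable (Z lam) by apply: bigcapT_measurable => k; exact: mU.
have PU lam k : 0 < lam -> (K0 <= k)%N ->
    (P (\bigcup_n H lam k n) <= ((a k + C * (l - S k)) / lam)%:E)%E.
  move=> lam0 Kk.
  (* Continuity from below passes from finite horizons to all later times. *)
  have ndH : nondecreasing_seq (H lam k).
    apply/nondecreasing_seqP => n; apply/subsetPset => w [i im Ui].
    by exists i => //; exact: leqW.
  have := nondecreasing_cvg_mu (mu := P) (mH lam k) (mU lam k) ndH.
  move=> /(cvg_lim (@ereal_hausdorff _)) <-.
  apply: lime_le.
    apply: ereal_nondecreasing_is_cvgn => i j ij.
    by apply: le_measure; rewrite ?inE//; apply/subsetPset; exact: ndH.
  by apply: nearW => n; exact: PH.
have PZ lam : 0 < lam -> P (Z lam) = 0%E.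
  move=> lam0; apply/eqP; rewrite eq_le measure_ge0 andbT.
  apply/lee_addgt0Pr => eps eps0; rewrite add0e.
  have [K _ HK] := (cvgr0Pnorm_le _).1 (bound_cvg lam) _ eps0.
  apply: (@le_trans _ _ (P (\bigcup_n H lam (K0 + K)%N n))).
    by apply: le_measure; rewrite ?inE// => w; exact.
  apply: le_trans (PU _ _ lam0 (leq_addr _ _)) _; rewrite lee_fin.
  by apply: le_trans (ler_norm _) _; apply: HK; exact: leq_addl.
(* Countably many levels suffice: if [v] exceeds [1 / (r + 1)] in absolute value, then [v ^+ e],
   hence [U], exceeds the [e]-th power of that number. *)
apply: (@negligibleS _ _ _ _ (\bigcup_r Z (r.+1%:R^-1 ^+ e))); last first.
  apply: negligible_bigcup => r; exists (Z (r.+1%:R^-1 ^+ e)); split => //.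
  by apply: PZ; rewrite exprn_gt0// invr_gt0.
move=> w /= nv; apply: contrapT => nZ; apply: nv; apply/cvgr0Pnorm_le => eps eps0.
have [r re] : exists r : nat, r.+1%:R^-1 <= eps.
  exists (Num.truncn eps^-1); rewrite -[leRHS]invrK lef_pV2 ?posrE ?invr_gt0//.
  by rewrite ltW// truncnS_gt.
have nZr : ~ Z (r.+1%:R^-1 ^+ e) w by move=> Zr; apply: nZ; exists r.
have [k Hk] : exists k, ~ (\bigcup_n H (r.+1%:R^-1 ^+ e) (K0 + k)%N n) w.
  by apply: contrapT => none; apply: nZr => k _; apply: contrapT => ?; apply: none; exists k.
exists (K0 + k)%N => // i /= ki; apply: le_trans re; rewrite leNgt; apply/negP => big.
apply: Hk; exists (i - (K0 + k))%N => //; exists (i - (K0 + k))%N => //.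
rewrite subnKC//; apply: (@le_trans _ _ (phi (word y i w))); last first.
  by rewrite /U lerDl mulr_ge0// subr_ge0.
rewrite /phi -[leRHS]ger0_norm; last exact: phi0.
by rewrite normrX lerXn2r ?nnegrE// ?invr_ge0// ltW.
Qed.
End NoiseConvergence.

(** * The strict Lyapunov function of the heavy ball *)

Section InnerProduct.
Variables (R : realType) (n : nat).
Implicit Types u v w : 'rV[R]_n.

Lemma dotrC u v : dotr u v = dotr v u.
Proof. by apply: eq_bigr => i _; rewrite mulrC. Qed.

Lemma dotrDl u v w : dotr (u + v) w = dotr u w + dotr v w.
Proof. by rewrite /dotr -big_split; apply: eq_bigr => i _; rewrite mxE mulrDl. Qed.

Lemma dotrZl a u v : dotr (a *: u) v = a * dotr u v.
Proof. by rewrite /dotr mulr_sumr; apply: eq_bigr => i _; rewrite mxE mulrA. Qed.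

Lemma dotrNl u v : dotr (- u) v = - dotr u v.
Proof. by rewrite -scaleN1r dotrZl mulN1r. Qed.

Lemma dotrDr u v w : dotr u (v + w) = dotr u v + dotr u w.
Proof. by rewrite dotrC dotrDl !(dotrC u). Qed.

Lemma dotrZr a u v : dotr u (a *: v) = a * dotr u v.
Proof. by rewrite dotrC dotrZl dotrC. Qed.

Lemma dotrNr u v : dotr u (- v) = - dotr u v.
Proof. by rewrite dotrC dotrNl dotrC. Qed.

Lemma dotr0r u : dotr u 0 = 0.
Proof. by rewrite -(scale0r u) dotrZr mul0r. Qed.

Lemma dotr_ge0 u : 0 <= dotr u u.
Proof. by apply: sumr_ge0 => i _; rewrite -expr2 sqr_ge0. Qed.

Lemma dotr_eq0 u : dotr u u <= 0 -> u = 0.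
Proof.
move=> u0; apply/rowP => i; rewrite mxE; apply/eqP; rewrite -sqrf_eq0 expr2.
have /eqP : dotr u u = 0 by apply/eqP; rewrite eq_le u0 dotr_ge0.
rewrite psumr_eq0 => [/allP/(_ i (mem_index_enum _))//|j _].
by rewrite -expr2 sqr_ge0.
Qed.

Lemma dotr_young a u v : 0 < a -> dotr u v <= a / 2 * dotr u u + (2 * a)^-1 * dotr v v.
Proof.
move=> a0; have := dotr_ge0 (a *: u - v).
rewrite !(dotrDl, dotrDr, dotrNl, dotrNr, dotrZl, dotrZr) (dotrC v u) => H.
have ai : 0 < (2 * a)^-1 by rewrite invr_gt0 mulr_gt0.
have := mulr_ge0 (ltW ai) H.
rewrite [X in 0 <= X -> _](_ : _ = a / 2 * dotr u u - dotr u v + (2 * a)^-1 * dotr v v); first lra.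
by field; rewrite !gt_eqF.
Qed.

Lemma ler_norm_coord u i : `|u 0 i| <= `|u|.
Proof.
have := le_bigmax_cond (0 : R) (fun i : 'I_1 * 'I_n => `|u i.1 i.2|) (j := (0, i)) (P := xpredT) erefl.
by rewrite /= /Num.norm/= mx_normrE.
Qed.

Lemma ler_norm_sum_coord u : `|u| <= \sum_i `|u 0 i|.
Proof.
rewrite [leLHS]/Num.norm/= mx_normrE; apply: bigmax_le => [|[i j] _ /=].
  exact: sumr_ge0.
by rewrite (ord1 i) (bigD1 j)//= lerDl sumr_ge0.
Qed.

(** [|u|] is the maximum norm while [dotr] is Euclidean, hence the factor [n]. *)
Lemma ler_norm_dotr u v : `|dotr u v| <= n%:R * (`|u| * `|v|).
Proof.
apply: le_trans (ler_norm_sum _ _ _) _.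
apply: (@le_trans _ _ (\sum_(i < n) `|u| * `|v|)).
  apply: ler_sum => i _; rewrite normrM.
  by apply: ler_pM => //; exact: ler_norm_coord.
by rewrite sumr_const card_ord mulr_natl.
Qed.

Lemma continuous_dotr (T : topologicalType) (f g : T -> 'rV[R]_n) :
  continuous f -> continuous g -> continuous (fun x => dotr (f x) (g x)).
Proof.
move=> cf cg; apply: (continuous_big (fun z => add_continuous z)) => i _ x; apply: cvgM.
  by apply: (continuous_comp (f := f) (g := fun M : 'rV[R]_n => M 0 i)); [exact: cf|exact: coord_continuous].
by apply: (continuous_comp (f := g) (g := fun M : 'rV[R]_n => M 0 i)); [exact: cg|exact: coord_continuous].
Qed.

Lemma enorm_sqr u : enorm u ^+ 2 = dotr u u.
Proof. by rewrite sqr_sqrtr// dotr_ge0. Qed.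

Lemma enorm_ge0 u : 0 <= enorm u.
Proof. exact: sqrtr_ge0. Qed.

Lemma diff_dotr (f : 'rV[R]_n -> R) q v : differentiable f q -> 'd f q v = dotr (grad f q) v.
Proof.
move=> df; rewrite [X in 'd f q X]row_sum_delta linear_sum; apply: eq_bigr => i _.
by rewrite linearZ/= mxE mulrC.
Qed.

End InnerProduct.

(** * Descent estimates and one-step Lyapunov bounds *)

Section SmoothPotential.
Variables (R : realType) (n : nat) (Psi : 'rV[R]_n -> R).
Hypothesis dPsi : forall q, differentiable Psi q.
Notation G := (grad Psi).

Lemma mean_value_grad q v :
  exists2 c : R, 0 <= c <= 1 & Psi (q + v) - Psi q = dotr (G (q + c *: v)) v.
Proof.
pose f (t : R) := Psi (t *: v + q).
have fE (t h : R) : f (h + t) = Psi (h *: v + (t *: v + q)).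
  by rewrite /f scalerDl addrA.
have der (t : R) : is_derive t (1 : R) f (dotr (G (t *: v + q)) v).
  have d1 : derivable Psi (t *: v + q) v by exact: diff_derivable.
  have e1 : (fun h : R => h^-1 *: ((f \o shift t) (h *: (1 : R)) - f t)) =
      (fun h => h^-1 *: ((Psi \o shift (t *: v + q)) (h *: v) - Psi (t *: v + q))).
    by apply/funext => h /=; rewrite [h *: (1 : R)]mulr1 fE.
  split; rewrite /derivable /derive e1//.
  by rewrite -(diff_dotr _ (dPsi _)) -deriveE.
have [c c01] := @MVT_segment R f _ 0 1 ler01 (fun t _ => der t)
  (derivable_within_continuous (fun t _ => @ex_derive _ _ _ _ _ _ _ (der t))).
rewrite /f scale1r scale0r add0r subr0 mulr1 (addrC v) => ->.
by exists c; [move: c01; rewrite in_itv|rewrite addrC].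
Qed.

Variable L : R.
Hypothesis L0 : 0 < L.
Hypothesis lipG : forall x x', dotr (G x - G x') (G x - G x') <= L ^+ 2 * dotr (x - x') (x - x').

(** Young's inequality with weight [1 / (L s)] balances the two squares. *)
Lemma lip_dotr q v w (s : R) : 0 < s ->
  dotr (G (q + s *: v) - G q) w <= L * s / 2 * (dotr v v + dotr w w).
Proof.
move=> s0; have Ls : 0 < (L * s)^-1 by rewrite invr_gt0 mulr_gt0.
have H := dotr_young (G (q + s *: v) - G q) w Ls.
have eq : q + s *: v - q = s *: v by rewrite (addrC q) addrK.
have := lipG (q + s *: v) q; rewrite eq dotrZl dotrZr => K.
have := ler_wpM2l (ltW Ls) K.
rewrite [X in _ <= X -> _](_ : _ = L * s * dotr v v) => [K'|]; last first.
  by field; rewrite !gt_eqF.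
move: H; rewrite (_ : (2 * (L * s)^-1)^-1 = L * s / 2); first lra.
by field; rewrite !gt_eqF.
Qed.

(** The mean value form avoids integration and gives [L] in place of the sharper [L / 2]. The
    intermediate point [c = 0] is treated apart, as [lip_dotr] asks for a positive step. *)
Lemma descent q v : Psi (q + v) - Psi q <= dotr (G q) v + L * dotr v v.
Proof.
have [c /andP[c0 c1] ->] := mean_value_grad q v.
have v0 := dotr_ge0 v; have Lv : 0 <= L * dotr v v by rewrite mulr_ge0// ltW.
have [->|cn0] := eqVneq c 0; first by rewrite scale0r addr0 lerDl.
have cp : 0 < c by rewrite lt_neqAle eq_sym cn0.
have := lip_dotr q v v cp; rewrite dotrDl dotrNl.
have -> : L * c / 2 * (dotr v v + dotr v v) = c * (L * dotr v v) by field.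
have cLv : c * (L * dotr v v) <= L * dotr v v by rewrite ler_piMl.
by rewrite lerBlDl => /le_trans; apply; rewrite lerD2l.
Qed.

(** A gradient step of length [1 / (2 L)] lowers [Psi] by at least [1 / (4 L)] times the squared
    gradient, and cannot pass below [Psis0]. *)
Lemma grad_le_gap Psis0 q : (forall q', Psis0 <= Psi q') ->
  dotr (G q) (G q) <= 4 * L * (Psi q - Psis0).
Proof.
move=> Hmin; pose c := (2 * L)^-1; have Lc : L * c = 1 / 2 by rewrite /c; field; rewrite gt_eqF.
have := descent q (- c *: G q); have := Hmin (q + - c *: G q).
rewrite dotrZr dotrZl dotrZr; clearbody c.
move: (Psi q) (Psi _) (dotr _ _) => x x' g H1.
rewrite (_ : L * _ = L * c * (c * g)); last by ring.
rewrite Lc => H2; have : L * (c * g) <= L * (2 * (x - Psis0)) by rewrite ler_pM2l//; lra.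
by rewrite (mulrA L c) Lc; lra.
Qed.

(** The squared gradient attains its minimum on a compact set, and a zero there would be a critical
    point whose value is not [Psis0]. *)
Lemma grad_lower_bound (M eps Psis0 : R) : 0 < eps -> continuous G ->
  (forall q, G q = 0 -> Psi q = Psis0) ->
  exists2 g : R, 0 < g & forall q, `|q| <= M -> Psis0 + eps <= Psi q -> g <= dotr (G q) (G q).
Proof.
move=> eps0 cG crit; pose A := [set q | `|q| <= M] `&` [set q | Psis0 + eps <= Psi q].
have cPsi : continuous Psi by move=> q; exact: differentiable_continuous.
have cA : compact A.
  apply: bounded_closed_compact.
    exists M; split; first exact: num_real.
    by move=> M' MM' q [/= qM _]; exact: le_trans qM (ltW MM').
  apply: closedI.
    by apply: (@closed_comp _ _ (fun q : 'rV[R]_n => `|q|) [set x | x <= M]) => [q _|];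
      [exact: norm_continuous|exact: closed_le].
  by apply: (@closed_comp _ _ Psi [set x | Psis0 + eps <= x]) => [q _|];
    [exact: cPsi|exact: closed_ge].
have [A0|/set0P A0] := eqVneq A set0.
  exists 1 => // q qM qe; have : A q by split.
  by rewrite A0.
have [|c cA' minc] := @EVT_min_rV R n (fun q => dotr (G q) (G q)) A A0 cA.
  exact/continuous_subspaceT/continuous_dotr.
exists (dotr (G c) (G c)).
  rewrite lt_neqAle dotr_ge0 andbT eq_sym; apply/eqP => gc0.
  have /crit : G c = 0 by apply: dotr_eq0; rewrite gc0.
  by move: cA'; rewrite inE => -[_ /=]; lra.
by move=> q qM qe; apply: minc; rewrite inE; split.
Qed.

Variables (kappa a Psis0 : R).
(** The energy dissipates only through [p]; the cross term adds a decrease proportional to the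
    squared gradient. *)
Definition lyap (q p : 'rV[R]_n) : R :=
  Psi q - Psis0 + dotr p p / 2 + a * dotr (G q) p.

Hypothesis kappa0 : 0 < kappa.
Hypothesis a0 : 0 < a.
Hypothesis Hmin : forall q, Psis0 <= Psi q.
Hypothesis aL : 8 * L * a ^+ 2 <= 1.
Hypothesis ak : a * (L + kappa ^+ 2 / 2) <= kappa / 2.

(** Young bounds the cross term by [dotr p p / 4] plus [a ^+ 2] times the squared gradient, and
    [grad_le_gap] with [aL] bounds the latter by half of the gap [Psi q - Psis0]. *)
Lemma lyap_ge q p : (Psi q - Psis0) / 2 + dotr p p / 4 <= lyap q p.
Proof.
have a2 : 0 < 2 * a by rewrite mulr_gt0.
have [aL' L0'] := (aL, L0).
have := dotr_young (G q) (- p) a2; rewrite dotrNr dotrNl dotrNr opprK => /(ler_wpM2l (ltW a0)).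
rewrite [leRHS](_ : _ = a ^+ 2 * dotr (G q) (G q) + dotr p p / 4); last by field; rewrite !gt_eqF.
have /(ler_wpM2l (sqr_ge0 a)) := grad_le_gap q Hmin.
have : 8 * L * a ^+ 2 * (Psi q - Psis0) <= 1 * (Psi q - Psis0).
  by rewrite ler_wpM2r// subr_ge0.
rewrite /lyap; lra.
Qed.

Lemma lyap_le q p : lyap q p <= Psi q - Psis0 + dotr p p + a ^+ 2 / 2 * dotr (G q) (G q).
Proof.
have := dotr_young (G q) p a0 => /(ler_wpM2l (ltW a0)).
rewrite [leRHS](_ : _ = a ^+ 2 / 2 * dotr (G q) (G q) + dotr p p / 2); last by field; rewrite !gt_eqF.
rewrite /lyap; lra.
Qed.

(** The three lines of the bound are the dissipation, the effect of the gradient error [e], and the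
    discretisation error. The terms in [dotr (G q) p] from potential and kinetic energy cancel; [ak]
    lets half of the friction absorb what the cross term produces in [dotr p p]. *)
Lemma lyap_flow q p xi s (F := - (kappa *: p) - xi) (e := xi - G q) : 0 < s ->
  lyap (q + s *: p) (p + s *: F) - lyap q p <=
    s * (- (kappa / 2 * dotr p p + a / 2 * dotr (G q) (G q))) +
    s * (- dotr p e - a * dotr (G q) e) +
    s * (s * ((L + a * L) * dotr p p + (1 + a * L) * dotr F F)).
Proof.
move=> s0.
have d1 := descent q (s *: p); rewrite dotrZr dotrZl dotrZr in d1.
have d2 := lip_dotr q p p s0.
have d3 := lip_dotr q p F s0.
have Gp : - dotr (G q) p <= (2 * kappa)^-1 * dotr (G q) (G q) + kappa / 2 * dotr p p.
  have := @dotr_young _ _ kappa (- p) (G q) kappa0.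
  by rewrite dotrC dotrNr dotrNl dotrNr opprK; lra.
have Gp' : - (a * kappa * dotr (G q) p) <=
    a / 2 * dotr (G q) (G q) + a * kappa ^+ 2 / 2 * dotr p p.
  have ak0 : 0 <= a * kappa by rewrite mulr_ge0// ltW.
  have := ler_wpM2l ak0 Gp.
  rewrite [leRHS](_ : _ = a / 2 * dotr (G q) (G q) + a * kappa ^+ 2 / 2 * dotr p p); first lra.
  by field; rewrite !gt_eqF.
have pF : dotr p F = - (kappa * dotr p p) - dotr (G q) p - dotr p e.
  rewrite /F /e dotrDr !dotrNr dotrZr dotrDr dotrNr (dotrC p (G q)); lra.
have GF : dotr (G q) F = - (kappa * dotr (G q) p) - dotr (G q) (G q) - dotr (G q) e.
  rewrite /F /e dotrDr !dotrNr dotrZr dotrDr dotrNr; lra.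
clearbody F e.
have pp : dotr (p + s *: F) (p + s *: F) =
    dotr p p + 2 * s * dotr p F + s ^+ 2 * dotr F F.
  by rewrite !(dotrDl, dotrDr, dotrZl, dotrZr) (dotrC F p); ring.
rewrite /lyap pp; clear Gp pp; move: d1 d2 d3 Gp' pF GF.
move: (G (q + s *: p)) (G q) (Psi (q + s *: p)) (Psi q) => G1 G0 x1 x0 d1 d2 d3 Gp' pF GF.
have GG : dotr G1 (p + s *: F) = dotr G0 p + s * dotr G0 F
    + dotr (G1 - G0) p + s * dotr (G1 - G0) F.
  by rewrite dotrDr dotrZr !dotrDl !dotrNl; ring.
rewrite GG.
have P0 := dotr_ge0 p; have F0 := dotr_ge0 F.
have m2 := ler_wpM2l (ltW a0) d2.
have as0 : 0 <= a * s by rewrite mulr_ge0// ltW.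
have m3 := ler_wpM2l as0 d3.
have m4 := ler_wpM2l (ltW s0) Gp'.
have m5 : s * (a * (L + kappa ^+ 2 / 2) * dotr p p) <= s * (kappa / 2 * dotr p p).
  by rewrite ler_pM2l// ler_wpM2r.
have r1 : 0 <= s * s * dotr F F by rewrite mulr_ge0// mulr_ge0// ltW.
have r2 : 0 <= s * s * (a * L) * dotr p p.
  by rewrite mulr_ge0// mulr_ge0// ?mulr_ge0 ?ltW.
have r3 : 0 <= s * s * (a * L) * dotr F F.
  by rewrite mulr_ge0// mulr_ge0// ?mulr_ge0 ?ltW.
move: d1 m2 m3 m4 m5; rewrite pF GF; clear -r1 r2 r3.
lra.
Qed.

(** The reset discards the kinetic energy and the cross term, whose part along [xi] is nonnegative
    at a jump. *)
Lemma lyap_jump q p xi : 0 <= dotr xi p ->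
  lyap q 0 - lyap q p <= - (a * dotr (G q - xi) p).
Proof.
move=> xp; rewrite /lyap !dotr0r mul0r mulr0 addr0 dotrDl dotrNl.
have := dotr_ge0 p; have := mulr_ge0 (ltW a0) xp; lra.
Qed.

End SmoothPotential.

(** * Limit points of inexact heavy-ball paths *)

Section HeavyBallLimit.
Variables (R : realType) (n : nat) (Psi : 'rV[R]_n -> R) (kappa T L M : R).
Variables (z : nat -> stateHB R n * 'rV[R]_n) (t : nat -> R).
Notation G := (grad Psi).
Notation q i := (z i).1.1.1.
Notation p i := (z i).1.1.2.
Notation timer i := (z i).1.2.
Notation xi i := (z i).2.

(** The fast component of [x'] is left free; the hypotheses [err] and [zM] control it. The step [s]
    is the increment of the clock [t]. *)
Definition hb_flow (s : R) (x x' : stateHB R n * 'rV[R]_n) : Prop :=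
  [/\ 0 < s, Cbig T x & x'.1 = x.1 + s *: F_HB kappa T x.1 x.2].
Definition hb_jump (s : R) (x x' : stateHB R n * 'rV[R]_n) : Prop :=
  [/\ s = 0, Dbig T x & x'.1 = G_HB x.1].

Hypothesis kappa0 : 0 < kappa.
Hypothesis T0 : 0 < T.
Hypothesis L0 : 0 < L.
Hypothesis dPsi : forall x, differentiable Psi x.
Hypothesis cG : continuous G.
Hypothesis lipG : forall x x', dotr (G x - G x') (G x - G x') <= L ^+ 2 * dotr (x - x') (x - x').
Hypothesis crit : forall x, (forall x', Psi x <= Psi x') <-> G x = 0.
Hypothesis zM : forall i, `|z i| <= M.
Hypothesis tinf : t @ \oo --> +oo.
Hypothesis ds : forall eps, 0 < eps -> exists I, forall i, (I <= i)%N -> t i.+1 - t i <= eps.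
Hypothesis err : forall eps, 0 < eps -> exists I, forall i, (I <= i)%N -> `|xi i - G (q i)| <= eps.
Hypothesis step : forall i, hb_flow (t i.+1 - t i) (z i) (z i.+1) \/ hb_jump (t i.+1 - t i) (z i) (z i.+1).

Lemma hb_flowP s x x' : hb_flow s x x' ->
  [/\ x'.1.1.1 = x.1.1.1 + s *: x.1.1.2,
      x'.1.1.2 = x.1.1.2 + s *: (- (kappa *: x.1.1.2) - x.2) &
      x'.1.2 = x.1.2 + s * Num.min 1 (2 - x.1.2 / T)].
Proof. by move=> [_ _ ->]. Qed.

Lemma timer_rate (tm : R) : Num.min 1 (2 - tm / T) = if tm <= T then 1 else 2 - tm / T.
Proof.
have T0' := T0; have TT : T / T = 1 by rewrite mulfV ?gt_eqF.
case: leP => tmT; case: leP => //.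
- have : tm / T <= T / T by rewrite ler_pM2r ?invr_gt0.
  lra.
- have : T / T < tm / T by rewrite ltr_pM2r ?invr_gt0.
  lra.
Qed.

Lemma t_mono i : t i <= t i.+1.
Proof. by rewrite -subr_ge0; case: (step i) => [[/ltW]//|[-> ]]. Qed.

Lemma norm_q i : `|q i| <= M.
Proof. by apply: le_trans (zM i); rewrite !prod_normE !le_max lexx. Qed.
Lemma norm_p i : `|p i| <= M.
Proof. by apply: le_trans (zM i); rewrite !prod_normE !le_max lexx !orbT. Qed.
Lemma norm_timer i : `|timer i| <= M.
Proof. by apply: le_trans (zM i); rewrite !prod_normE !le_max lexx !orbT. Qed.
Lemma norm_xi i : `|xi i| <= M.
Proof. by apply: le_trans (zM i); rewrite !prod_normE !le_max lexx !orbT. Qed.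

Lemma M_ge0 : 0 <= M.
Proof. exact: le_trans (norm_q 0). Qed.

(** Above [2 T + eps] the timer falls at a rate of at least [eps / T], and a step no longer than [T]
    started below [2 T] cannot overshoot it. *)
Lemma timer_upper eps : 0 < eps -> exists I, forall i, (I <= i)%N -> timer i <= 2 * T + eps.
Proof.
move=> eps0; have T0' := T0; have [I HI] := ds T0.
have eT : 0 < eps / T by rewrite divr_gt0.
have E : (2 * T + eps) / T = 2 + eps / T by field; rewrite gt_eqF.
have E' : 2 * T / T = 2 by field; rewrite gt_eqF.
apply: (@drift_eventually _ (fun i => timer i) t I (eps / T) (- M) (2 * T + eps)) => //.
- by move=> i _; exact: t_mono.
- by move=> i _; have /ler_normlP[] := norm_timer i; lra.
- move=> i Ii /= big; case: (step i) => [fl|[-> _ ->]]; last first.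
    by rewrite /= mulr0 subr0; lra.
  have [s0 _ _] := fl; have [_ _ ->] := hb_flowP fl.
  rewrite timer_rate ifF; last by apply/negbTE; rewrite -ltNge; lra.
  have : (2 * T + eps) / T < timer i / T by rewrite ltr_pM2r ?invr_gt0.
  by rewrite E; nra.
- move=> i Ii /= small; case: (step i) => [fl|[_ _ ->]]; last by rewrite /=; lra.
  have [s0 _ _] := fl; have [_ _ ->] := hb_flowP fl; have sT := HI _ Ii.
  rewrite timer_rate; case: (leP (timer i) T) => tT; first by lra.
  have [big|big] := leP (2 * T) (timer i).
    have : 2 * T / T <= timer i / T by rewrite ler_pM2r ?invr_gt0.
    rewrite E' => big2.
    have : 0 <= (t i.+1 - t i) * (timer i / T - 2) by rewrite mulr_ge0 ?subr_ge0 ?t_mono.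
    by lra.
  have u : (2 * T - timer i) / T = 2 - timer i / T by rewrite mulrBl E'.
  have : (t i.+1 - t i) * ((2 * T - timer i) / T) <= 2 * T - timer i.
    rewrite mulrCA ler_piMr//; first by rewrite subr_ge0 ltW.
    by rewrite ler_pdivrMr// mul1r.
  by rewrite u; lra.
Qed.

(** Below zero the timer grows at rate one and no jump is possible; from a nonnegative value, a
    reset or a step no longer than [T] stays nonnegative. *)
Lemma timer_lower : exists I, forall i, (I <= i)%N -> 0 <= timer i.
Proof.
have T0' := T0; have [I HI] := ds T0.
have [|||||J HJ] := @drift_eventually _ (fun i => - timer i) t I 1 (- M) 0 0 ltr01 (lexx _).
- by move=> i _; exact: t_mono.
- exact: tinf.
- by move=> i _; have /ler_normlP[] := norm_timer i; lra.
- move=> i Ii /= big; case: (step i) => [fl|[_ [_ tT] _]]; last by lra.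
  have [s0 _ _] := fl; have [_ _ ->] := hb_flowP fl.
  by rewrite timer_rate ifT; lra.
- move=> i Ii /= small; case: (step i) => [fl|[_ _ ->]]; last by rewrite /= oppr0.
  have [s0 _ _] := fl; have [_ _ ->] := hb_flowP fl; have sT := HI _ Ii.
  rewrite timer_rate; case: (leP (timer i) T) => tT; first by lra.
  have : (t i.+1 - t i) * (timer i / T) <= timer i.
    rewrite mulrCA ler_piMr//; first exact: ltW (lt_trans T0 tT).
    by rewrite ler_pdivrMr// mul1r.
  by lra.
by exists J => i Ji; have := HJ i Ji; lra.
Qed.

Section Lyapunov.
Variables (a Psis0 : R).
Hypothesis a0 : 0 < a.
Hypothesis Hmin : forall x, Psis0 <= Psi x.
Hypothesis Hcrit : forall x, G x = 0 -> Psi x = Psis0.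
Hypothesis aL : 8 * L * a ^+ 2 <= 1.
Hypothesis ak : a * (L + kappa ^+ 2 / 2) <= kappa / 2.
Notation W i := (lyap Psi a Psis0 (q i) (p i)).

(** By [lyap_le], [W i > eps] makes [dotr p p], the gradient term or the gap [Psi - Psis0] at least
    a fixed fraction of [eps]; the minimum [eta] has one argument for each case. *)
Lemma lyap_dissipation eps : 0 < eps -> exists2 eta : R, 0 < eta &
  forall i, eps < W i -> eta <= kappa / 2 * dotr (p i) (p i) + a / 2 * dotr (G (q i)) (G (q i)).
Proof.
move=> eps0; have e20 : 0 < eps / 2 by rewrite divr_gt0.
have [g g0 Hg] := @grad_lower_bound _ _ _ dPsi M _ Psis0 e20 cG Hcrit.
have a2 : 0 < a ^+ 2 by rewrite exprn_gt0.
pose eta := Num.min (kappa / 2 * (eps / 4)) (Num.min (a / 2 * g) (a / 2 * (eps / 4 / (a ^+ 2 / 2)))).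
exists eta.
  by rewrite !lt_min; apply/and3P; split; repeat (apply: divr_gt0 || apply: mulr_gt0) => //.
move=> i We; have := lyap_le Psi Psis0 a0 (q i) (p i).
have P0 := dotr_ge0 (p i); have G0 := dotr_ge0 (G (q i)).
have kp : 0 <= kappa / 2 * dotr (p i) (p i) by rewrite mulr_ge0// divr_ge0// ltW.
have aG : 0 <= a / 2 * dotr (G (q i)) (G (q i)) by rewrite mulr_ge0// divr_ge0// ltW.
move=> le.
have [p1|p1] := leP (eps / 4) (dotr (p i) (p i)).
  apply: (@le_trans _ _ (kappa / 2 * (eps / 4))); first by rewrite /eta ge_min lexx.
  by apply: (@le_trans _ _ (kappa / 2 * dotr (p i) (p i))); [rewrite ler_pM2l// divr_gt0|rewrite lerDl].
apply: (@le_trans _ _ (a / 2 * dotr (G (q i)) (G (q i)))); last by rewrite lerDr.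
have a20 : 0 < a / 2 by rewrite divr_gt0.
have [g1|g1] := leP (eps / 4) (a ^+ 2 / 2 * dotr (G (q i)) (G (q i))).
  apply: (@le_trans _ _ (a / 2 * (eps / 4 / (a ^+ 2 / 2)))); first by rewrite /eta !ge_min lexx !orbT.
  rewrite ler_pM2l// ler_pdivrMr ?divr_gt0//; by rewrite [leRHS]mulrC.
apply: (@le_trans _ _ (a / 2 * g)); first by rewrite /eta !ge_min lexx !orbT.
rewrite ler_pM2l//; apply: Hg; first exact: norm_q.
move: We le p1 g1; move: (W i) (Psi _) (dotr _ _) (_ * dotr _ _) => *; lra.
Qed.

Lemma lyap_step delta : 0 < delta -> exists I, forall i, (I <= i)%N ->
  (hb_flow (t i.+1 - t i) (z i) (z i.+1) ->
   W i.+1 - W i <= (t i.+1 - t i) *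
     (2 * delta - (kappa / 2 * dotr (p i) (p i) + a / 2 * dotr (G (q i)) (G (q i))))) /\
  (hb_jump (t i.+1 - t i) (z i) (z i.+1) -> W i.+1 - W i <= delta).
Proof.
move=> d0; have M0 := M_ge0.
(* [K1] collects the coefficients of the error [e], and [K2] bounds the second-order terms; the
   added ones keep both positive. The gradient is bounded as [xi - e] once the error is at most
   one. *)
pose K1 := n%:R * (M + a * (M + 1)) + 1.
have K10 : 0 < K1 by rewrite ltr_pwDr// mulr_ge0// addr_ge0// mulr_ge0 ?addr_ge0// ltW.
pose K2 := (L + a * L) * (n%:R * (M * M)) +
  (1 + a * L) * (n%:R * ((kappa * M + M) * (kappa * M + M))) + 1.
have aL0 : 0 <= a * L by rewrite mulr_ge0// ltW.
have kM : 0 <= kappa * M + M by rewrite addr_ge0// mulr_ge0// ltW.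
have K20 : 0 < K2.
  rewrite ltr_pwDr// addr_ge0// mulr_ge0// ?mulr_ge0//; first by rewrite addr_ge0// ltW.
  by rewrite addr_ge0.
have [I1 H1] := err ltr01.
have dK1 : 0 < delta / K1 by rewrite divr_gt0.
have dK2 : 0 < delta / K2 by rewrite divr_gt0.
have [I2 H2] := err dK1; have [I3 H3] := ds dK2.
exists (maxn I1 (maxn I2 I3)) => i; rewrite !geq_max => /and3P[/H1 e1 /H2 e2 /H3 s3].
set e := xi i - G (q i) in e1 e2.
have eK : K1 * `|e| <= delta by rewrite mulrC -ler_pdivlMr.
have nG : `|G (q i)| <= M + 1.
  rewrite (_ : G (q i) = xi i - e); last by rewrite /e opprB addrCA subrr addr0.
  by apply: le_trans (ler_normB _ _) _; apply: lerD => //; exact: norm_xi.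
have pe : `|dotr (p i) e| <= n%:R * M * `|e|.
  apply: le_trans (ler_norm_dotr _ _) _; rewrite -mulrA ler_wpM2l//.
  by rewrite ler_wpM2r//; exact: norm_p.
have Ge : `|dotr (G (q i)) e| <= n%:R * (M + 1) * `|e|.
  apply: le_trans (ler_norm_dotr _ _) _; rewrite -mulrA ler_wpM2l//.
  by rewrite ler_wpM2r.
have e0 : 0 <= `|e| by [].
have nMe : 0 <= n%:R * M * `|e| by rewrite !mulr_ge0.
have nM1e : 0 <= n%:R * (M + 1) * `|e| by rewrite !mulr_ge0// addr_ge0.
have aGe := ler_wpM2l (ltW a0) Ge.
have K1E : K1 * `|e| = n%:R * M * `|e| + a * (n%:R * (M + 1) * `|e|) + `|e|.
  by rewrite /K1; ring.
split=> [fl|jp].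
  have [s0 _ _] := fl; have [-> -> _] := hb_flowP fl.
  have := lyap_flow dPsi L0 lipG Psis0 kappa0 a0 ak (q i) (p i) (xi i) s0.
  rewrite -/e; set F := - (kappa *: p i) - xi i; move=> /le_trans; apply.
  rewrite -!mulrDr ler_pM2l//.
  have nF : `|F| <= kappa * M + M.
    apply: le_trans (ler_normB _ _) _; apply: lerD; last exact: norm_xi.
    by rewrite normrN normrZ gtr0_norm// ler_pM2l//; exact: norm_p.
  have PP : dotr (p i) (p i) <= n%:R * (M * M).
    apply: le_trans (ler_norm _) _; apply: le_trans (ler_norm_dotr _ _) _.
    by rewrite ler_wpM2l// ler_pM//; exact: norm_p.
  have FF : dotr F F <= n%:R * ((kappa * M + M) * (kappa * M + M)).
    apply: le_trans (ler_norm _) _; apply: le_trans (ler_norm_dotr _ _) _.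
    by rewrite ler_wpM2l// ler_pM.
  have CK : (L + a * L) * dotr (p i) (p i) + (1 + a * L) * dotr F F <= K2.
    apply: (@le_trans _ _ (K2 - 1)); last by rewrite gerBl.
    rewrite /K2 addrK; apply: lerD; apply: ler_wpM2l => //.
      by rewrite addr_ge0// ltW.
    by rewrite addr_ge0.
  have sC : (t i.+1 - t i) * ((L + a * L) * dotr (p i) (p i) + (1 + a * L) * dotr F F) <= delta.
    apply: (@le_trans _ _ ((t i.+1 - t i) * K2)); first by rewrite ler_pM2l.
    by rewrite -ler_pdivlMr.
  have Ee : - dotr (p i) e - a * dotr (G (q i)) e <= delta.
    apply: le_trans eK; rewrite K1E.
    move: pe aGe => /ler_normlP[pe _]; rewrite -[X in X * `|_|](gtr0_norm a0) -normrM.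
    by move=> /ler_normlP[aGe _]; move: pe aGe e0; lra.
  move: sC Ee; lra.
have [_ [_ xp] ->] := jp; rewrite /=.
have [_ [xip _] _] := jp.
have := @lyap_jump _ _ Psi a Psis0 a0 (q i) (p i) (xi i) xip => /le_trans; apply.
rewrite -(opprB (xi i)) -/e dotrNl mulrN opprK; apply: le_trans eK; rewrite K1E.
have : a * dotr e (p i) <= a * (n%:R * (M + 1) * `|e|).
  rewrite ler_pM2l// dotrC; apply: le_trans (ler_norm _) _; apply: le_trans pe _.
  by rewrite ler_wpM2r// ler_wpM2l// lerDl.
by move: nMe e0; lra.
Qed.

(* Adding de * timer to the Lyapunov function pays for the small increases at jumps,
   because each jump resets a timer that has reached T. *)
Lemma lyap_eventually eps : 0 < eps -> exists I, forall i, (I <= i)%N -> W i <= 4 * eps.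
Proof.
move=> eps0; have [eta eta0 Heta] := lyap_dissipation eps0.
have M0 := M_ge0; have M1 : 0 < M + 1 by rewrite ltr_pwDr.
(* The timer term may cost a quarter of the dissipation rate [eta] and must stay within [eps] in
   absolute value. *)
pose de := Num.min (eta / 4) (eps / (M + 1)).
have de0 : 0 < de by rewrite lt_min !divr_gt0.
have de_eta : de <= eta / 4 by rewrite ge_min lexx.
have deM : de * (M + 1) <= eps by rewrite -ler_pdivlMr// ge_min lexx orbT.
(* Together with [de] this leaves half of [eta] along flows, and the amount [de * T] released by the
   reset covers the increase [dl] at a jump. *)
pose dl := Num.min (eta / 8) (de * T).
have dl0 : 0 < dl by rewrite lt_min divr_gt0// mulr_gt0.
have dl_eta : dl <= eta / 8 by rewrite ge_min lexx.
have dlT : dl <= de * T by rewrite ge_min lexx orbT.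
have [I1 H1] := lyap_step dl0.
have [I2 H2] := ds (divr_gt0 eps0 eta0).
have detM i : `|de * timer i| <= eps.
  rewrite normrM gtr0_norm//; apply: le_trans deM.
  by rewrite ler_pM2l//; apply: le_trans (norm_timer i) _; rewrite lerDl.
pose b i := W i + de * timer i.
have bflow i : (I1 <= i)%N -> hb_flow (t i.+1 - t i) (z i) (z i.+1) ->
    b i.+1 <= b i + (t i.+1 - t i) * (eta / 2 -
      (kappa / 2 * dotr (p i) (p i) + a / 2 * dotr (G (q i)) (G (q i)))).
  move=> Ii fl; have [/(_ fl) + _] := H1 _ Ii; rewrite /b.
  set D := (kappa / 2 * _ + _); have [s0 _ _] := fl; have [_ _ ->] := hb_flowP fl.
  set r := Num.min _ _; have r1 : r <= 1 by rewrite /r ge_min lexx.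
  set s := t i.+1 - t i in s0 *.
  have : s * (2 * dl + de * r) <= s * (eta / 2).
    rewrite ler_pM2l//; have : de * r <= de * 1 by rewrite ler_pM2l.
    by lra.
  by move: (W i.+1) (W i) => x y; lra.
have bjump i : (I1 <= i)%N -> hb_jump (t i.+1 - t i) (z i) (z i.+1) -> b i.+1 <= b i.
  move=> Ii jp; have [_ /(_ jp)] := H1 _ Ii; rewrite /b.
  have [_ [_ tT] e1] := jp; rewrite [in timer i.+1]e1 /= mulr0.
  have : de * T <= de * timer i by rewrite ler_pM2l.
  by move: (W i.+1) (W i) => x y; lra.
have D0 i : 0 <= kappa / 2 * dotr (p i) (p i) + a / 2 * dotr (G (q i)) (G (q i)).
  by rewrite addr_ge0// mulr_ge0// ?dotr_ge0// divr_ge0// ltW.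
(* [b > 2 * eps] gives [W > eps], hence dissipation; steps of at most [eps / eta] keep one step from
   [2 * eps] within [3 * eps], and undoing the timer term costs one more [eps]. *)
have [|||||||I3 H3] := @drift_eventually _ b t (maxn I1 I2) (eta / 2) (- eps) (2 * eps) (3 * eps).
- by rewrite divr_gt0.
- by lra.
- by move=> i _; exact: t_mono.
- exact: tinf.
- move=> i _; rewrite /b; have /ler_normlP[] := detM i.
  have := lyap_ge dPsi L0 lipG a0 Hmin aL (q i) (p i).
  have := dotr_ge0 (p i); have := Hmin (q i); move: (W i) (dotr _ _) => w dd; lra.
- move=> i; rewrite geq_max => /andP[Ii1 Ii2] bi.
  have We : eps < W i by move: bi; rewrite /b; have /ler_normlP[] := detM i; lra.
  case: (step i) => [fl|jp]; last first.
    by have [-> _ _] := jp; rewrite mulr0 subr0; exact: bjump.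
  have [s0 _ _] := fl; apply: le_trans (bflow _ Ii1 fl) _; rewrite lerD2l.
  have := Heta _ We; rewrite -mulNr -subr_ge0 [(- _) * _]mulrC => De.
  by rewrite ler_pM2l//; lra.
- move=> i; rewrite geq_max => /andP[Ii1 Ii2] bi.
  case: (step i) => [fl|jp]; last first.
    by apply: le_trans (bjump _ Ii1 jp) _; lra.
  have [s0 _ _] := fl; apply: le_trans (bflow _ Ii1 fl) _.
  have := H2 _ Ii2; rewrite ler_pdivlMr// => se.
  have := mulr_ge0 (ltW s0) (D0 i); lra.
exists I3 => i Ii; have := H3 i Ii; rewrite /b; have /ler_normlP[] := detM i; lra.
Qed.

End Lyapunov.

Lemma hb_limit_Mset (u : nat -> nat) (chi : stateHB R n) (xmin : 'rV[R]_n) :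
  (forall x, Psi xmin <= Psi x) ->
  (forall m, exists I, forall i, (I <= i)%N -> (m <= u i)%N) ->
  (fun i => (z (u i)).1) @ \oo --> chi -> Mset Psi T chi.
Proof.
move=> xminP uinf cchi.
have T0' := T0; have k0 := kappa0; have L0' := L0.
have kk : 0 < L + kappa ^+ 2 / 2 by rewrite ltr_pwDl// divr_ge0// sqr_ge0.
(* The first bound on [a] gives [ak]; the second gives both [a <= 1] and [8 L a <= 1], hence
   [aL]. *)
pose a := Num.min (kappa / 2 / (L + kappa ^+ 2 / 2)) (1 + 8 * L)^-1.
have L8 : 0 < 1 + 8 * L by lra.
have a0 : 0 < a by rewrite lt_min invr_gt0 L8 divr_gt0// divr_gt0.
have ak : a * (L + kappa ^+ 2 / 2) <= kappa / 2 by rewrite -ler_pdivlMr// ge_min lexx.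
have aL1 : a * (1 + 8 * L) <= 1 by rewrite -ler_pdivlMr// mul1r ge_min lexx orbT.
have aL : 8 * L * a ^+ 2 <= 1.
  have : a <= 1 by apply: le_trans aL1; rewrite ler_peMr//; lra.
  have : 0 <= L * a by rewrite mulr_ge0// ltW.
  by rewrite expr2; nra.
have Hcrit x : G x = 0 -> Psi x = Psi xmin.
  by move=> /crit xP; apply/eqP; rewrite eq_le xP xminP.
have ev (f : stateHB R n -> R) (c : R) : continuous f ->
    (exists I, forall i, (I <= i)%N -> f (z i).1 <= c) -> f chi <= c.
  move=> cf [I HI].
  have fcvg : (fun i => f (z (u i)).1) @ \oo --> f chi.
    by apply: (continuous_cvg _ (f := fun i => (z (u i)).1) (h := f)) => //; exact: cf.
  rewrite -(cvg_lim (@Rhausdorff R) fcvg); apply: limr_le; first by apply/cvg_ex; exists (f chi).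
  by have [J HJ] := uinf I; exists J => // i Ji; exact/HI/HJ.
have cq : continuous (fun x : stateHB R n => x.1.1).
  by move=> x; apply: (continuous_comp (f := fst) (g := fst)); exact: cvg_fst.
have cp : continuous (fun x : stateHB R n => x.1.2).
  by move=> x; apply: (continuous_comp (f := fst) (g := snd)); [exact: cvg_fst|exact: cvg_snd].
have ct : continuous (fun x : stateHB R n => x.2) by move=> x; exact: cvg_snd.
have cW : continuous (fun x : stateHB R n => lyap Psi a (Psi xmin) x.1.1 x.1.2).
  have cPsi : continuous (fun x : stateHB R n => Psi x.1.1).
    move=> x; apply: (continuous_comp (f := fun x : stateHB R n => x.1.1) (g := Psi)).
      exact: cq.
    exact/differentiable_continuous/dPsi.
  have cGq : continuous (fun x : stateHB R n => G x.1.1).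
    move=> x; apply: (continuous_comp (f := fun x : stateHB R n => x.1.1) (g := G)).
      exact: cq.
    exact: cG.
  move=> x; apply: cvgD; first apply: cvgD.
  - by apply: cvgB; [exact: cPsi|exact: cvg_cst].
  - by apply: cvgM; [exact: (continuous_dotr cp cp)|exact: cvg_cst].
  - by apply: cvgM; [exact: cvg_cst|exact: (continuous_dotr cGq cp)].
have W0 : lyap Psi a (Psi xmin) chi.1.1 chi.1.2 <= 0.
  apply/ler_addgt0Pr => eps eps0; rewrite add0r.
  apply: (ev _ _ cW); have e4 : 0 < eps / 4 by rewrite divr_gt0.
  have [I HI] := lyap_eventually a0 xminP Hcrit aL ak e4.
  by exists I => i /HI; rewrite mulrC divfK.
have := lyap_ge dPsi L0 lipG a0 xminP aL chi.1.1 chi.1.2.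
have := dotr_ge0 chi.1.2; have := xminP chi.1.1.
move: W0; set w := lyap _ _ _ _ _; set pp := dotr _ _ => W0 q1 p1 wl.
have Pq : Psi chi.1.1 <= Psi xmin by lra.
split; last split.
- by move=> x'; exact: le_trans Pq _.
- by apply: dotr_eq0; rewrite -/pp; lra.
- apply/andP; split.
    rewrite -oppr_le0; apply: (ev (fun x => - x.2)).
      by move=> x; apply: cvgN; exact: ct.
    by have [I HI] := timer_lower; exists I => i /HI; rewrite oppr_le0.
  apply/ler_addgt0Pr => eps eps0; apply: (ev _ _ ct).
  exact: timer_upper.
Qed.

End HeavyBallLimit.

(** * Solutions of the simulator *)

Lemma least_nat (P : nat -> Prop) : (exists j, P j) ->
  exists j, P j /\ forall j', P j' -> (j <= j')%N.
Proof.
move=> exP; have exb : exists j, `[< P j >] by case: exP => j /asboolP; exists j.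
by case: (ex_minnP exb) => j /asboolP Pj jmin; exists j; split => // j' /asboolP /jmin.
Qed.

(** Closed conditions on accumulation points are obtained by writing each as [g <= 0] with [g]
    continuous; along the sequence the bound is asked for only up to a vanishing error. *)
Lemma cluster_le0 (R : realType) (X : topologicalType) (u : nat -> X) (g : X -> R) (c : X) :
  continuous g -> acc_pts u c ->
  (forall eps, 0 < eps -> exists I, forall i, (I <= i)%N -> g (u i) <= eps) -> g c <= 0.
Proof.
move=> cg uc H; rewrite leNgt; apply/negP => gc0.
have gc2 : 0 < g c / 2 by rewrite divr_gt0.
have [I HI] := H _ gc2.
have gn : nbhs c [set x | g c / 2 < g x].
  apply: (cg c [set y | g c / 2 < y]); apply: open_nbhs_nbhs; split; first exact: open_gt.
  by rewrite /=; lra.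
have un : (u @ \oo) [set x | g x <= g c / 2] by exists I.
have [x [/= gx xg]] := uc _ _ un gn.
by move: gx; rewrite leNgt xg.
Qed.

Section HybridSolution.
Variables (R : realType) (n : nat) (kappa T : R) (hs hf : nat -> R).
Variables (gam : nat -> 'rV[R]_n -> 'rV[R]_n) (phi : hseq (stateHB R n * 'rV[R]_n)).
Hypothesis T0 : 0 < T.
Hypothesis hs_adm : admissible hs.
Hypothesis cphi : hcomplete phi.
Hypothesis flowP : forall k j, hd phi (k, j) -> hd phi (k.+1, j) ->
  [/\ Cbig T (hv phi k j),
      (hv phi k.+1 j).1 = (hv phi k j).1 + hs k.+1 *: F_HB kappa T (hv phi k j).1 (hv phi k j).2 &
      (hv phi k.+1 j).2 = (hv phi k j).2 + hf k.+1 *: (gam k.+1 (hv phi k j).1.1.1 - (hv phi k j).2)].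
Hypothesis jumpP : forall k j, hd phi (k, j) -> hd phi (k, j.+1) ->
  [/\ Dbig T (hv phi k j), (hv phi k j.+1).1 = G_HB (hv phi k j).1 &
      (hv phi k j.+1).2 = (hv phi k j).2].

(** The first jump resets the timer to zero, below the threshold [T] of the second. *)
Lemma no_double_jump k j : hd phi (k, j) -> hd phi (k, j.+1) -> hd phi (k, j.+2) -> False.
Proof.
move=> h0 h1 h2; have [_ e _] := jumpP h0 h1; have [[_ tT] _ _] := jumpP h1 h2.
by move: tT; rewrite e /= leNgt T0.
Qed.

Lemma jump_count_le k j : hd phi (k, j) -> (j <= k.+1)%N.
Proof.
have [pi [dpi pi0 piE pS]] := hcomplete_path cphi.
(* After [i] steps [i <= 2 k], or [i <= 2 k + 1] with a jump as last step; in the second case the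
   next step must be a flow. *)
have inv i : (i <= (pi i).1.*2)%N \/ (i <= (pi i).1.*2.+1)%N /\
    exists2 i', i = i'.+1 & pi i = ((pi i').1, (pi i').2.+1).
  elim: i => [|i IH]; first by left.
  case: (pS i) => e; first by left; rewrite e /=; case: IH => [|[]]; lia.
  right; split; last by exists i.
  rewrite e /=; case: IH => [|[_ [i' ei e']]]; first by lia.
  have h1 := dpi i; have h2 := dpi i.+1.
  rewrite e in h2; rewrite e' /= in h1 h2.
  by exfalso; apply: (@no_double_jump (pi i').1 (pi i').2) => //; have := dpi i'; case: (pi i').
by move=> h; have := inv (k + j)%N; rewrite (piE _ _ h) /=; lia.
Qed.

Lemma solution_complete_k : hcomplete_k phi.
Proof.
move=> m; apply: contrapT => none; apply: cphi; exists (m + m).+1 => k j h.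
have km : (k < m)%N by rewrite ltnNge; apply/negP => mk; apply: none; exists k, j.
by have := jump_count_le h; lia.
Qed.

Lemma domain_k k : exists j, hd phi (k, j).
Proof.
have [k' [j [h kk']]] := solution_complete_k k.
have [pi [dpi pi0 piE pS]] := hcomplete_path cphi.
suff [i <-] : exists i, (pi i).1 = k by exists (pi i).2; have := dpi i; case: (pi i).
have : (k <= (pi (k' + j)%N).1)%N by rewrite (piE _ _ h).
elim: (k' + j)%N => [|i IH]; first by rewrite pi0 leqn0 => /eqP ->; exists 0%N; rewrite pi0.
case: (pS i) => e; rewrite [in (_ <= _)%N]e /=; last exact: IH.
by rewrite leq_eqVlt => /predU1P[->|]; [exists i.+1; rewrite e|exact: IH].
Qed.

(** Minimality of [jbar phi k] excludes a jump into [(k + 1, jbar phi k)], so its predecessor is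
    [(k, jbar phi k)]: this is the level on which [k] flows to [k + 1]. *)
Lemma jbarP k : hd phi (k, jbar phi k) /\ hd phi (k.+1, jbar phi k).
Proof.
have [h1 hmin] : hd phi (k.+1, jbar phi k) /\
    forall j', hd phi (k.+1, j') -> (jbar phi k <= j')%N.
  exact: (xgetPex 0%N (least_nat (domain_k k.+1))).
split => //; have [//|[k0 [->]]//|[j0 ej h0]] := hdom_pred (hdP phi) h1.
by have := hmin _ h0; rewrite ej ltnn.
Qed.

(** The mirror image of [jbarP]; the bound [j <= kbar phi j] sends [kbar] to infinity, so that the
    gradient error vanishes along the jumps. *)
Lemma kbarP j k : hd phi (k, j.+1) ->
  [/\ hd phi (kbar phi j, j), hd phi (kbar phi j, j.+1) & (j <= kbar phi j)%N].
Proof.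
move=> h.
have [h1 hmin] : hd phi (kbar phi j, j.+1) /\
    forall k', hd phi (k', j.+1) -> (kbar phi j <= k')%N.
  exact: (xgetPex 0%N (least_nat (ex_intro _ k h))).
split => //; last by have := jump_count_le h1.
have [|[k0 ek h0]|[j0 [->]]//] := hdom_pred (hdP phi) h1; first by rewrite addnS.
by have := hmin _ h0; rewrite ek ltnn.
Qed.

Lemma slow_fast_const k j j' : hd phi (k, j) -> hd phi (k, j') ->
  (hv phi k j).1.1.1 = (hv phi k j').1.1.1 /\ (hv phi k j).2 = (hv phi k j').2.
Proof.
have H d i : hd phi (k, i) -> hd phi (k, (i + d)%N) ->
    (hv phi k i).1.1.1 = (hv phi k (i + d)).1.1.1 /\ (hv phi k i).2 = (hv phi k (i + d)).2.
  move=> hi; elim: d => [|d IH] hd1; first by rewrite addn0.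
  rewrite addnS in hd1 *.
  have [|[k0 ek h0]|[j0 [ej] h0]] := hdom_pred (hdP phi) hd1; first by rewrite addnS.
    by have := hdom_mono (hdP phi) h0 hi; rewrite ek ltnSn; lia.
  by rewrite -ej in h0; have [-> ->] := IH h0; have [_ -> ->] := jumpP h0 hd1.
move=> h h'; have [jj'|/ltnW jj'] := leqP j j'.
  by have := H (j' - j)%N _ h; rewrite subnKC//; exact.
by have := H (j - j')%N _ h'; rewrite subnKC// => /(_ h)[-> ->].
Qed.

(** [q] and the fast state do not depend on [j], but [p] does: [slow_p k] is the velocity after any
    jump at [k], the one that drives the next flow. *)
Definition slow_q k := (hv phi k (jbar phi k)).1.1.1.
Definition slow_p k := (hv phi k (jbar phi k)).1.1.2.
Definition fast_x k := (hv phi k (jbar phi k)).2.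

Lemma slow_fastE k j : hd phi (k, j) ->
  (hv phi k j).1.1.1 = slow_q k /\ (hv phi k j).2 = fast_x k.
Proof. by move=> h; apply: slow_fast_const => //; have [] := jbarP k. Qed.

Lemma slow_qS k : slow_q k.+1 = slow_q k + hs k.+1 *: slow_p k.
Proof.
have [h0 h1] := jbarP k; have [<- _] := slow_fastE h1.
by have [_ -> _] := flowP h0 h1.
Qed.

Lemma fast_xS k : fast_x k.+1 = fast_x k + hf k.+1 *: (gam k.+1 (slow_q k) - fast_x k).
Proof.
have [h0 h1] := jbarP k; have [_ <-] := slow_fastE h1.
by have [_ _ ->] := flowP h0 h1.
Qed.

Variables (Psi : 'rV[R]_n -> R) (L M : R).
Notation G := (grad Psi).
Hypothesis kappa0 : 0 < kappa.
Hypothesis L0 : 0 < L.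
Hypothesis dPsi : forall x, differentiable Psi x.
Hypothesis cG : continuous G.
Hypothesis lipG : forall x x', dotr (G x - G x') (G x - G x') <= L ^+ 2 * dotr (x - x') (x - x').
Hypothesis crit : forall x, (forall x', Psi x <= Psi x') <-> G x = 0.
Hypothesis phiM : forall k j, hd phi (k, j) -> `|hv phi k j| <= M.
Hypothesis err : (fun k => fast_x k - G (slow_q k)) @ \oo --> (0 : 'rV[R]_n).

Lemma err_le eps : 0 < eps -> exists I, forall i, (I <= i)%N -> `|fast_x i - G (slow_q i)| <= eps.
Proof. by move=> /((cvgr0Pnorm_le _).1 err) [I _ HI]; exists I. Qed.

Lemma omega_limit_Mset (xmin : 'rV[R]_n) : (forall x, Psi xmin <= Psi x) ->
  omega_limit (hmap fst phi) `<=` Mset Psi T.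
Proof.
move=> xminP chi [kj [kjd kjinf kjcvg]].
have [pi [dpi pi0 piE pS]] := hcomplete_path cphi.
(* Along the staircase path the state becomes an ordinary sequence, with the clock [tau hs] read at
   the [k] coordinate and so constant over jumps. *)
pose z i := hv phi (pi i).1 (pi i).2; pose t i := tau hs (pi i).1.
have dpi' i : hd phi ((pi i).1, (pi i).2) by have := dpi i; case: (pi i).
have kinf m : exists I, forall i, (I <= i)%N -> (m <= (pi i).1)%N.
  exists (m + m).+1 => i Ii.
  have ii : ((pi i).1 + (pi i).2 = i)%N.
    elim: {Ii} i => [|i IH]; first by rewrite pi0.
    by case: (pS i) => ->/=; rewrite ?addnS ?addSn IH.
  by have := jump_count_le (dpi' i); lia.
have tauS k : tau hs k.+1 - tau hs k = hs k.+1.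
  by rewrite /tau big_nat_recr//= addrAC subrr add0r.
have [hpos h0 _] := hs_adm.
apply: (@hb_limit_Mset _ _ _ kappa T L M z t kappa0 T0 L0 dPsi cG lipG crit _ _ _ _ _
   (fun i => (kj i).1 + (kj i).2)%N chi xmin xminP _ _).
- by move=> i; exact: phiM.
- apply/cvgryPge => A; have /cvgryPge/(_ A)[I _ HI] := tau_cvg_pinfty hs_adm.
  by have [J HJ] := kinf I; exists J => // i /HJ; exact: HI.
- move=> eps eps0; have [I _ HI] := (cvgr0Pnorm_le _).1 h0 _ eps0.
  have [J HJ] := kinf I; exists J => i Ji; rewrite /t; case: (pS i) => -> /=.
    by rewrite tauS; apply: le_trans (ler_norm _) (HI _ (leqW (HJ _ Ji))).
  by rewrite subrr ltW.
- move=> eps /err_le[I HI]; have [J HJ] := kinf I; exists J => i Ji.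
  by rewrite /z; have [-> ->] := slow_fastE (dpi' i); exact/HI/HJ.
- move=> i; rewrite /z /t; have := dpi' i.+1; case: (pS i) => -> /= h'.
    left; have [c e _] := flowP (dpi' i) h'; split => //; first by rewrite tauS hpos.
    by rewrite tauS.
  by right; have [c e _] := jumpP (dpi' i) h'; split => //; rewrite subrr.
- exact: kjinf.
- rewrite (_ : (fun i => _) = (fun i => hv (hmap fst phi) (kj i).1 (kj i).2))//.
  apply/funext => i; rewrite /z piE//.
  by have := kjd i; case: (kj i).
Qed.

Lemma jump_direction_gradient k j : hd phi (k, j) ->
  `|dotr (fast_x k) (hv phi k j).1.1.2 - dotr (G (slow_q k)) (hv phi k j).1.1.2| <=
    n%:R * M * `|fast_x k - G (slow_q k)|.
Proof.
move=> h; rewrite -dotrNl -dotrDl; apply: le_trans (ler_norm_dotr _ _) _.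
rewrite -mulrA ler_wpM2l// mulrC ler_wpM2r//.
by apply: le_trans (phiM h); rewrite !prod_normE !le_max lexx !orbT.
Qed.

(** The signs in [Cbig] and [Dbig] involve the fast state, those in [C_HB] and [D_HB] the true
    gradient; the difference vanishes uniformly in [j]. *)
Lemma jump_direction_cvg eps : 0 < eps -> exists I, forall k j, (I <= k)%N -> hd phi (k, j) ->
  `|dotr (fast_x k) (hv phi k j).1.1.2 - dotr (G (slow_q k)) (hv phi k j).1.1.2| <= eps.
Proof.
move=> eps0; have M0 : 0 <= M.
  by have [j h] := domain_k 0; apply: le_trans (phiM h).
have K0 : 0 < n%:R * M + 1 by rewrite ltr_pwDr// mulr_ge0.
have [I HI] := err_le (divr_gt0 eps0 K0).
exists I => k j /HI e h; apply: le_trans (jump_direction_gradient h) _.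
apply: (@le_trans _ _ ((n%:R * M + 1) * `|fast_x k - G (slow_q k)|)).
  by rewrite ler_wpM2r// lerDl.
by rewrite mulrC -ler_pdivlMr.
Qed.

Lemma continuous_state_q : continuous (fun x : stateHB R n => x.1.1).
Proof. by move=> x; apply: (continuous_comp (f := fst) (g := fst)); exact: cvg_fst. Qed.

Lemma continuous_state_p : continuous (fun x : stateHB R n => x.1.2).
Proof.
by move=> x; apply: (continuous_comp (f := fst) (g := snd)); [exact: cvg_fst|exact: cvg_snd].
Qed.

Lemma continuous_state_grad : continuous (fun x : stateHB R n => G x.1.1).
Proof.
move=> x; apply: (continuous_comp (f := fun x : stateHB R n => x.1.1) (g := G)).
  exact: continuous_state_q.
exact: cG.
Qed.

Lemma continuous_state_dotr : continuous (fun x : stateHB R n => dotr (G x.1.1) x.1.2).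
Proof. exact: continuous_dotr continuous_state_grad continuous_state_p. Qed.

Lemma continuous_Fflow_HB : continuous (Fflow_HB Psi kappa T).
Proof.
move=> x.
have cF : (fun y : stateHB R n => - (kappa *: y.1.2) - G y.1.1) @ x -->
    - (kappa *: x.1.2) - G x.1.1.
  apply: cvgB; last exact: continuous_state_grad.
  apply: cvgN; apply: cvgZ; first exact: cvg_cst.
  exact: continuous_state_p.
have ct : {for x, continuous (fun y : stateHB R n => Num.min 1 (2 - y.2 / T))}.
  apply: (continuous_min (f := fun=> 1) (g := fun y : stateHB R n => 2 - y.2 / T)).
    exact: cvg_cst.
  apply: cvgB; first exact: cvg_cst.
  by apply: cvgM; [exact: cvg_snd|exact: cvg_cst].
exact: (cvg_pair (cvg_pair (@continuous_state_p x) cF) ct).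
Qed.

Lemma continuous_G_HB : continuous (@G_HB R n).
Proof.
move=> x; have c0 : {for x, continuous (fun _ : stateHB R n => 0 : 'rV[R]_n)} by exact: cvg_cst.
have c1 : {for x, continuous (fun _ : stateHB R n => 0 : R)} by exact: cvg_cst.
exact: (cvg_pair (cvg_pair (@continuous_state_q x) c0) c1).
Qed.

Lemma norm_le0_eq (x y : stateHB R n) : `|x - y| <= 0 -> x = y.
Proof. by rewrite normr_le0 subr_eq0 => /eqP. Qed.

Lemma solution_asymptotic_simulation :
  asymptotic_simulation (C_HB Psi T) (Fflow_HB Psi kappa T) (D_HB Psi T) (@G_HB R n)
    (hmap fst phi) hs.
Proof.
have T0' := T0; have k0 := kappa0.
have M0 : 0 <= M by have [j h] := domain_k 0; apply: le_trans (phiM h).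
have nx k j : hd phi (k, j) -> `|(hv phi k j).1| <= M.
  by move=> h; apply: le_trans (phiM h); rewrite [leRHS]prod_normE le_max lexx.
split => //.
- by exists M => k j /nx.
- move=> _; pose x k := (hv phi k (jbar phi k)).1.
  have xd k : hd phi (k, jbar phi k) by have [] := jbarP k.
  (* [f] uses the fast state, so it is exactly the flow increment divided by the step; the gradient
     enters only at accumulation points. *)
  pose f k := F_HB kappa T (x k) (fast_x k).
  exists f; split.
  + exists (M + (kappa * M + M) + (3 + M / T)) => k.
    have kM : 0 <= kappa * M by rewrite mulr_ge0// ltW.
    have MT : 0 <= M / T by rewrite divr_ge0// ltW.
    have := phiM (xd k); rewrite !prod_normE !ge_max.
    move=> /andP[/andP[/andP[nq np] nt] nxi]; rewrite /f /F_HB /= -/(x k) in nq np nt nxi *.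
    rewrite -andbA; apply/and3P; split.
    * by apply: le_trans np _; lra.
    * apply: le_trans (ler_normB _ _) _; rewrite normrN normrZ (gtr0_norm k0).
      have : kappa * `|(x k).1.2| <= kappa * M by rewrite ler_pM2l.
      have : `|fast_x k| <= M by exact: nxi.
      by lra.
    * have : `|(x k).2 / T| <= M / T.
        by rewrite normrM normfV (gtr0_norm T0') ler_pM2r ?invr_gt0.
      move=> /ler_normlP[t1 t2]; rewrite ler_norml le_min ge_min.
      by apply/andP; split; [apply/andP; split|apply/orP; left]; lra.
  + move=> [c b] cb.
    have fst_c : continuous (fun y : stateHB R n * stateHB R n => y.1) by move=> y; exact: cvg_fst.
    have comp_c (g : stateHB R n -> R) : continuous g ->
        continuous (fun y : stateHB R n * stateHB R n => g y.1).
      move=> cg y; apply: (continuous_comp (f := fst) (g := g)); [exact: fst_c|exact: cg].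
    split => /=.
      have [tT|tT] := leP c.2 T; first by right.
      left; split; last exact: ltW.
      (* The minimum turns the alternative in [Cbig] into a single continuous inequality, whose
         second branch is excluded by [tT]. *)
      have c0 : Num.min (dotr (G c.1.1) c.1.2) (c.2 - T) <= 0.
        apply: (@cluster_le0 _ _ _ (fun y : stateHB R n * stateHB R n =>
          Num.min (dotr (G y.1.1.1) y.1.1.2) (y.1.2 - T)) (c, b) _ cb) => [|eps eps0].
          apply: (@comp_c (fun y => Num.min (dotr (G y.1.1) y.1.2) (y.2 - T))) => y.
          apply: (continuous_min (f := fun y : stateHB R n => dotr (G y.1.1) y.1.2)
             (g := fun y : stateHB R n => y.2 - T)); first exact: continuous_state_dotr.
          by apply: cvgB; [exact: cvg_snd|exact: cvg_cst].
        have [I HI] := jump_direction_cvg eps0; exists I => k Ik /=.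
        have [h0 h1] := jbarP k; have [Ck _ _] := flowP h0 h1.
        case: Ck => [[xp _]|tk]; rewrite ge_min; apply/orP; [left|right; lra].
        by have /ler_normlP[d1 _] := HI _ _ Ik h0; move: xp d1; rewrite /x -/(fast_x k) -/(slow_q k); lra.
      by move: c0; rewrite ge_min => /orP[//|]; lra.
    apply: norm_le0_eq; apply: (@cluster_le0 _ _ _ (fun y : stateHB R n * stateHB R n =>
          `|y.2 - Fflow_HB Psi kappa T y.1|) (c, b) _ cb) => [y|eps eps0].
      apply: cvg_norm; apply: cvgB; first exact: cvg_snd.
      by apply: (continuous_comp (f := fst) (g := Fflow_HB Psi kappa T));
        [exact: fst_c|exact: continuous_Fflow_HB].
    have [I HI] := err_le eps0; exists I => k /HI e /=.
    rewrite (_ : f k - _ = ((0, G (slow_q k) - fast_x k), 0)).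
      by rewrite !prod_normE /= !normr0 distrC !ge_max e (ltW eps0).
    rewrite /f /Fflow_HB /F_HB -/(x k) -/(slow_q k); congr ((_, _), _) => /=.
    * by rewrite subrr.
    * by rewrite opprB addrC addrA subrK.
    * by rewrite subrr.
  (* Every summand is zero by the choice of [f]. *)
  + move=> T' T'0 eps eps0; exists 0%N => m _ k _ _.
    rewrite big1_seq ?normr0 ?ltW// => i _.
    have [h0 h1] := jbarP i; have [_ e _] := flowP h0 h1.
    rewrite /= e addrAC subrr add0r scalerA mulVf ?scale1r ?subrr ?scaler0//.
    by have [hpos _ _] := hs_adm; rewrite gt_eqF ?hpos.
- move=> cj.
  have kd j : [/\ hd phi (kbar phi j, j), hd phi (kbar phi j, j.+1) & (j <= kbar phi j)%N].
    have [k [j' [h jj']]] := cj j.+1.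
    have [pi [dpi pi0 piE pS]] := hcomplete_path cphi.
    suff [i ei] : exists i, (pi i).2 = j.+1.
      by apply: (@kbarP j (pi i).1); rewrite -ei; have := dpi i; case: (pi i).
    have : (j.+1 <= (pi (k + j')%N).2)%N by rewrite (piE _ _ h).
    elim: (k + j')%N => [|i IH]; first by rewrite pi0.
    case: (pS i) => e; rewrite [in (_ <= _)%N]e /=; first exact: IH.
    by rewrite leq_eqVlt => /predU1P[->|]; [exists i.+1; rewrite e|exact: IH].
  move=> [c b] cb.
  have fst_c : continuous (fun y : stateHB R n * stateHB R n => y.1) by move=> y; exact: cvg_fst.
  split => /=; first split.
  + rewrite -oppr_le0; apply: (@cluster_le0 _ _ _ (fun y : stateHB R n * stateHB R n =>
      - dotr (G y.1.1.1) y.1.1.2) (c, b) _ cb) => [y|eps eps0].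
      apply: cvgN; apply: (continuous_comp (f := fst) (g := fun y : stateHB R n => dotr (G y.1.1) y.1.2));
        [exact: fst_c|exact: continuous_state_dotr].
    have [I HI] := jump_direction_cvg eps0; exists I => j Ij /=.
    have [h0 h1 jk] := kd j; have [[xp _] _ _] := jumpP h0 h1.
    have := HI _ _ (leq_trans Ij jk) h0; have [-> ex] := slow_fastE h0.
    by move: xp; rewrite ex => xp /ler_normlP[_ d1]; lra.
  + rewrite -subr_le0; apply: (@cluster_le0 _ _ _ (fun y : stateHB R n * stateHB R n =>
      T - y.1.2) (c, b) _ cb) => [y|eps eps0].
      apply: cvgB; first exact: cvg_cst.
      by apply: (continuous_comp (f := fst) (g := snd)); [exact: fst_c|exact: cvg_snd].
    exists 0%N => j _ /=; have [h0 h1 jk] := kd j; have [[_ tT] _ _] := jumpP h0 h1.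
    by lra.
  + apply: norm_le0_eq; apply: (@cluster_le0 _ _ _ (fun y : stateHB R n * stateHB R n =>
      `|y.2 - G_HB y.1|) (c, b) _ cb) => [y|eps eps0].
      apply: cvg_norm; apply: cvgB; first exact: cvg_snd.
      by apply: (continuous_comp (f := fst) (g := @G_HB R n));
        [exact: fst_c|exact: continuous_G_HB].
    exists 0%N => j _ /=; have [h0 h1 jk] := kd j; have [_ -> _] := jumpP h0 h1.
    by rewrite subrr normr0 ltW.
Qed.

End HybridSolution.

(** * Adaptedness and the gradient noise *)

Lemma filt_word (d : measure_display) (Tw : measurableType d) (N : nat)
    (y : nat -> Tw -> 'I_N) (k : nat) (A : set Tw) (w w' : Tw) :
  filt y k A -> word y k w = word y k w' -> A w -> A w'.
Proof.
(* The sets that do not separate [w] from [w'] form a sigma-algebra containing the generators. *)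
move=> fA ww'; suff H : filt y k `<=` [set B | B w <-> B w'] by case: (H A fA).
apply: smallest_sub.
  split => //= [B BH|B BH].
    by split => -[_ nB]; split => // /BH.
  by split => -[i _ /BH Bi]; exists i.
move=> _ [i [B [ik ->]]] /=.
suff -> : y i w = y i w' by [].
elim: k {fA} ww' ik => [|k IH] /=; first by lia.
move=> [e1 e2] /andP[i0]; rewrite leq_eqVlt => /predU1P[->//|ik].
by apply: IH => //; rewrite i0.
Qed.

Section GradientAverage.
Variables (R : realType) (n N : nat) (Psi : 'rV[R]_n -> R) (Psis : 'I_N -> 'rV[R]_n -> R).
Hypothesis N0 : (0 < N)%N.
Hypothesis PsiE : forall q, Psi q = (N%:R)^-1 * \sum_(i < N) Psis i q.
Hypothesis dPsi : forall q, differentiable Psi q.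
Hypothesis dPsis : forall i q, differentiable (Psis i) q.

(** This gives the sampling noise mean zero. *)
Lemma sum_grad q : \sum_(i < N) grad (Psis i) q = N%:R *: grad Psi q.
Proof.
apply/rowP => j; rewrite summxE !mxE.
have ds i : derivable (Psis i) q (delta_mx 0 j) by exact: diff_derivable.
have -> : Psi = N%:R^-1 \*: (\sum_(i < N) Psis i).
  by apply/funext => x; rewrite PsiE /= fct_sumE.
rewrite -deriveE; last first.
  have <- // : Psi = N%:R^-1 \*: (\sum_(i < N) Psis i).
  by apply/funext => x; rewrite PsiE /= fct_sumE.
rewrite deriveZ; last exact: derivable_sum.
rewrite derive_sum// [_ *: _](_ : _ = N%:R^-1 * \sum_(i < N) 'D_(delta_mx 0 j) (Psis i) q)//.
rewrite mulrA mulfV ?mul1r ?pnatr_eq0 -?lt0n//.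
by apply: eq_bigr => i _; rewrite mxE deriveE.
Qed.

Lemma grad_error_bound (M : R) : continuous (grad Psi) -> (forall i, continuous (grad (Psis i))) ->
  exists B : R, forall c q, `|q| <= M -> `|grad (Psis c) q - grad Psi q| <= B.
Proof.
move=> cG cGs; pose A := [set q : 'rV[R]_n | `|q| <= M].
have [A0|/set0P A0] := eqVneq A set0.
  by exists 0 => c q qM; have : A q by []; rewrite A0.
have cA : compact A.
  apply: bounded_closed_compact.
    exists M; split; first exact: num_real.
    by move=> M' MM' q /= qM; exact: le_trans qM (ltW MM').
  by apply: (@closed_comp _ _ (fun q : 'rV[R]_n => `|q|) [set x | x <= M]) => [q _|];
    [exact: norm_continuous|exact: closed_le].
have ex c : exists B : R, forall q, `|q| <= M -> `|grad (Psis c) q - grad Psi q| <= B.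
  have [|q0 _ Hq0] := @EVT_max_rV R n (fun q => `|grad (Psis c) q - grad Psi q|) A A0 cA.
    apply: continuous_subspaceT => q.
    apply: (continuous_comp (f := fun x => grad (Psis c) x - grad Psi x) (g := fun u => `|u|)).
      by apply: continuousB; [exact: cGs|exact: cG].
    exact: norm_continuous.
  by exists `|grad (Psis c) q0 - grad Psi q0| => q qM; apply: Hq0; rewrite inE.
have [B HB] := choice ex; exists (\sum_c `|B c|) => c q qM.
apply: le_trans (HB c q qM) _; apply: le_trans (ler_norm _) _.
by rewrite (bigD1 c)//= lerDl sumr_ge0.
Qed.
End GradientAverage.

Section AdaptedPath.
Variables (R : realType) (d : measure_display) (Tw : measurableType d) (n N : nat).
Variables (y : nat -> Tw -> 'I_N) (X : Tw -> hseq (stateHB R n * 'rV[R]_n)).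
Hypothesis Xdom : forall w k, hd (X w) (k, jbar (X w) k).
Hypothesis Xq : forall w k j, hd (X w) (k, j) -> (hv (X w) k j).1.1.1 = slow_q (X w) k.
Hypothesis adapted : forall k, setvalued_measurable (filt y k)
  (fun w' => [set pz : R * (stateHB R n * 'rV[R]_n) |
    exists j, hd (X w') (k, j) /\ pz = (j%:R, hv (X w') k j)]).

(** Test adaptedness on an open set that contains points with [q] near [slow_q (X w) k] and none
    with [q = slow_q (X w') k]: the event of meeting it lies in [filt y k], so it cannot hold for
    [w] alone. *)
Lemma slow_q_word k w w' : word y k w = word y k w' -> slow_q (X w) k = slow_q (X w') k.
Proof.
move=> ww'; apply: contrapT => /eqP ne.
set a := slow_q (X w) k in ne *; set b := slow_q (X w') k in ne *.
pose O := [set pz : R * (stateHB R n * 'rV[R]_n) | `|pz.2.1.1.1 - a| < `|b - a|].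
have oO : open O.
  apply: (@open_comp _ _ (fun pz : R * (stateHB R n * 'rV[R]_n) => `|pz.2.1.1.1 - a|)
     [set x | x < `|b - a|]); last exact: open_lt.
  move=> pz _; apply: cvg_norm; apply: cvgB; last exact: cvg_cst.
  apply: (continuous_comp (f := snd) (g := fun x : stateHB R n * 'rV[R]_n => x.1.1.1)).
    exact: cvg_snd.
  apply: (continuous_comp (f := fst) (g := fun x : stateHB R n => x.1.1)); first exact: cvg_fst.
  exact: continuous_state_q.
have /(filt_word (@adapted k O oO) ww') [pz [[j [hj ->]]]] :
    ([set pz : R * (stateHB R n * 'rV[R]_n) | exists j, hd (X w) (k, j) /\
      pz = (j%:R, hv (X w) k j)] `&` O) !=set0.
  exists ((jbar (X w) k)%:R, hv (X w) k (jbar (X w) k)); split; first by exists (jbar (X w) k).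
  by rewrite /O /= -/(slow_q (X w) k) -/a subrr normr0 normr_gt0 subr_eq0 eq_sym.
by rewrite /O /= (Xq hj) -/b ltxx.
Qed.

(** Extends [slow_q] to a function of all words, as the noise filter requires; a word that no
    outcome produces gets the default [0]. *)
Definition word_q (s : seq 'I_N) : 'rV[R]_n :=
  xget 0 [set q | exists2 w, word y (size s) w = s & q = slow_q (X w) (size s)].

Lemma word_qE k w : word_q (word y k w) = slow_q (X w) k.
Proof.
have [w' e ->] : [set q | exists2 w', word y (size (word y k w)) w' = word y k w &
    q = slow_q (X w') (size (word y k w))] (word_q (word y k w)).
  by apply: xgetPex; exists (slow_q (X w) (size (word y k w))); exists w; rewrite ?size_word.
by rewrite size_word in e *; exact: slow_q_word.
Qed.
End AdaptedPath.

(** The response to the noise alone from zero initial state; [(size s').+1] is the time index of the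
    letter [c]. *)
Fixpoint noise_filter (R : realType) (N : nat) (h : nat -> R) (g : 'I_N -> seq 'I_N -> R)
    (s : seq 'I_N) : R :=
  if s is c :: s' then
    (1 - h (size s').+1) * noise_filter h g s' + h (size s').+1 * g c s'
  else 0.

(** In [x - G q - v] the noise cancels. What remains contracts at rate [hf] and is driven by the
    change of [G q], of order [hs = hf * (hs / hf)]. *)
Lemma fast_error_cvg0 (R : realType) (n : nat) (G : 'rV[R]_n -> 'rV[R]_n) (L M : R)
    (hs hf : nat -> R) (q p x gam : nat -> 'rV[R]_n) (v : 'I_n -> nat -> R) :
  0 < L ->
  (forall u u', dotr (G u - G u') (G u - G u') <= L ^+ 2 * dotr (u - u') (u - u')) ->
  two_timescale_admissible hs hf ->
  (forall k, `|p k| <= M) ->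
  (forall k, q k.+1 = q k + hs k.+1 *: p k) ->
  (forall k, x k.+1 = x k + hf k.+1 *: (gam k - x k)) ->
  (forall i k, v i k.+1 = (1 - hf k.+1) * v i k + hf k.+1 * (gam k - G (q k)) 0 i) ->
  (forall i, v i @ \oo --> (0 : R)) ->
  (fun k => x k - G (q k)) @ \oo --> (0 : 'rV[R]_n).
Proof.
move=> L0 lipG [hs_adm hf_adm ratio] pM qS xS vS v0.
have M0 : 0 <= M by exact: le_trans (pM 0).
have [hspos _ _] := hs_adm; have [hfpos hf0 _] := hf_adm.
pose e k := x k - G (q k); pose D k := G (q k) - G (q k.+1).
(* The Euclidean norm of [p] is at most the square root of [n] times [M], bounded here by
   [n * M]. *)
pose K := L * (n%:R * M).
have K0 : 0 <= K by rewrite /K mulr_ge0 ?mulr_ge0// ltW.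
have DK i k : `|D k 0 i| <= hs k.+1 * K.
  have h0 : 0 < hs k.+1 by rewrite hspos.
  suff : `|D k 0 i| ^+ 2 <= (hs k.+1 * K) ^+ 2.
    by rewrite ler_sqr// nnegrE mulr_ge0// ltW.
  rewrite real_normK ?num_real//.
  apply: (@le_trans _ _ (dotr (D k) (D k))).
    rewrite /dotr (bigD1 i)//= -expr2 lerDl.
    by apply: sumr_ge0 => j _; rewrite -expr2 sqr_ge0.
  apply: le_trans (lipG _ _) _; rewrite qS opprD addNKr -scaleN1r !(dotrZl, dotrZr).
  rewrite (_ : L ^+ 2 * _ = (hs k.+1 * L) ^+ 2 * dotr (p k) (p k)); last by ring.
  rewrite /K (mulrA (hs k.+1)) [leRHS]exprMn ler_wpM2l ?sqr_ge0//.
  apply: le_trans (ler_norm _) _; apply: le_trans (ler_norm_dotr _ _) _.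
  rewrite exprMn; apply: ler_pM => //.
  - by rewrite -natrX ler_nat; case: (n) => // m; rewrite expnS expn1 leq_pmulr.
  - by rewrite expr2; apply: ler_pM.
have ei i : (fun k => e k 0 i) @ \oo --> (0 : R).
  suff d0 : (fun k => `|e k 0 i - v i k|) @ \oo --> (0 : R).
    rewrite (_ : (fun k => e k 0 i) = (fun k => (e k 0 i - v i k) + v i k)); last first.
      by apply/funext => k; rewrite subrK.
    by rewrite -[X in _ --> X]addr0; apply: cvgD; [exact/norm_cvg0P|exact: v0].
  have [K1 _ HK1] := (cvgr0Pnorm_le hf).1 hf0 1 ltr01.
  apply: (@contraction_cvg0 _ _ (fun k => hf k.+1) (fun k => K * (hs k.+1 / hf k.+1)) K1).
  - move=> k Kk; rewrite ltW ?hfpos//=; apply: le_trans (ler_norm _) _.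
    exact/HK1/leqW.
  - exact: (tau_cvg_pinfty hf_adm).
  - rewrite -[X in _ --> X](mulr0 K); apply: cvgM; first exact: cvg_cst.
    by rewrite (cvg_shiftS (fun k => hs k / hf k)).
  - by [].
  - move=> k Kk; have h0 : 0 < hf k.+1 by rewrite hfpos.
    have h1 : hf k.+1 <= 1 by apply: le_trans (ler_norm _) _; exact/HK1/leqW.
    have -> : e k.+1 0 i - v i k.+1 = (1 - hf k.+1) * (e k 0 i - v i k) + D k 0 i.
      by rewrite vS /e /D xS !mxE; ring.
    apply: le_trans (ler_normD _ _) _; rewrite normrM ger0_norm ?subr_ge0// lerD2l.
    apply: le_trans (DK i k) _; rewrite le_eqVlt; apply/orP; left; apply/eqP.
    by field; rewrite gt_eqF.
apply/cvgr0Pnorm_le => eps eps0.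
have sum0 : (fun k => \sum_(i < n) `|e k 0 i|) @ \oo --> (0 : R).
  rewrite -[X in _ --> X](_ : \sum_(i < n) (0 : R) = 0); last by rewrite big1.
  apply: (cvg_big (fun z => add_continuous z)) => i _.
  by rewrite -(normr0 R); apply: cvg_norm; exact: ei.
have [I _ HI] := (cvgr0Pnorm_le _).1 sum0 _ eps0.
exists I => // k Ik; apply: le_trans (ler_norm_sum_coord _) _.
by apply: le_trans (ler_norm _) _; exact: HI.
Qed.

Theorem theorem3 (R : realType) (n N : nat) (Psi : 'rV[R]_n -> R)
    (Psis : 'I_N -> 'rV[R]_n -> R) (kappa T : R) (hs hf : nat -> R)
    (d : measure_display) (Tw : measurableType d) (P : probability Tw R)
    (y : nat -> Tw -> 'I_N) (X : Tw -> hseq (stateHB R n * 'rV[R]_n))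
    (Omegahat : set Tw) :
  0 < kappa -> 0 < T ->
  standing_assumption Psi Psis ->
  two_timescale_admissible hs hf ->
  (exists rho : R, 1 <= rho /\
     exists l : R, series (fun k => hf k.+1 `^ (1 + rho)) @ \oo --> l) ->
  iid_uniform P y ->
  solution_S Psis kappa T hs hf y X ->
  P.-negligible [set w | Omegahat w /\ ~ (hbounded (X w) /\ hcomplete (X w))] ->
  P.-negligible [set w | Omegahat w /\
     ~ (asymptotic_simulation (C_HB Psi T) (Fflow_HB Psi kappa T) (D_HB Psi T)
          (@G_HB R n) (hmap fst (X w)) hs
        /\ omega_limit (hmap fst (X w)) `<=` Mset Psi T)].
Proof.
move=> kappa0 T0 [[dPsi cG] cptPsi [L' lip'] crit [N0 PsiE C1Psis]] adm
  [rho [rho1 [l hl]]] iid [solX adX] bad0.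
have dPsis i q : differentiable (Psis i) q by have [] := C1Psis i.
have cGs i : continuous (grad (Psis i)) by have [] := C1Psis i.
pose L := `|L'| + 1; have L0 : 0 < L by rewrite ltr_pwDr.
have lipG x x' : dotr (grad Psi x - grad Psi x') (grad Psi x - grad Psi x') <=
    L ^+ 2 * dotr (x - x') (x - x').
  rewrite -!enorm_sqr -exprMn lerXn2r ?nnegrE ?mulr_ge0 ?enorm_ge0 ?(ltW L0)//.
  apply: le_trans (lip' x x') _; rewrite ler_wpM2r ?enorm_ge0//.
  by apply: le_trans (ler_norm _) _; rewrite lerDl.
(* A minimiser over the compact sublevel set of [Psi 0] is global. *)
have [xmin xminP] : exists xmin, forall x, Psi xmin <= Psi x.
  have [||c _ Hc] := @EVT_min_rV R n Psi [set q | Psi q <= Psi 0] _ (cptPsi (Psi 0)).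
  - by exists 0 => /=.
  - by apply: continuous_subspaceT => q; exact: differentiable_continuous.
  exists c => x; have [x0|/ltW x0] := leP (Psi x) (Psi 0); first by apply: Hc; rewrite inE.
  by apply: le_trans x0; apply: Hc; rewrite inE /=.
have cX w : hcomplete (X w) by have [] := solX w.
have flowX w k j : hd (X w) (k, j) -> hd (X w) (k.+1, j) ->
  [/\ Cbig T (hv (X w) k j),
      (hv (X w) k.+1 j).1 = (hv (X w) k j).1 + hs k.+1 *: F_HB kappa T (hv (X w) k j).1 (hv (X w) k j).2 &
      (hv (X w) k.+1 j).2 = (hv (X w) k j).2 +
        hf k.+1 *: (grad (Psis (y k.+1 w)) (hv (X w) k j).1.1.1 - (hv (X w) k j).2)].
  by have [_ + _] := solX w; apply.
have jumpX w k j : hd (X w) (k, j) -> hd (X w) (k, j.+1) ->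
  [/\ Dbig T (hv (X w) k j), (hv (X w) k j.+1).1 = G_HB (hv (X w) k j).1 &
      (hv (X w) k j.+1).2 = (hv (X w) k j).2].
  by have [_ _ +] := solX w; apply.
have Xdom w k : hd (X w) (k, jbar (X w) k).
  by have [] := jbarP T0 (cX w) (jumpX w) k.
have Xq w k j : hd (X w) (k, j) -> (hv (X w) k j).1.1.1 = slow_q (X w) k.
  by move=> /(slow_fastE T0 (cX w) (jumpX w)) [].
have wq := word_qE Xdom Xq adX.
have [hs_adm hf_adm ratio] := adm.
(* Truncation at level [M] bounds the noise on every word; taking [M] natural keeps the exceptional
   sets countable in number. *)
pose g (M : nat) (i : 'I_n) c s : R :=
  if `|word_q y X s| <= M%:R
  then (grad (Psis c) (word_q y X s) - grad Psi (word_q y X s)) 0 i else 0.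
pose v M i s := noise_filter hf (g M i) s.
pose bad M i := [set w | ~ ((fun k => v M i (word y k w)) @ \oo --> (0 : R))].
have badN M i : P.-negligible (bad M i).
  have [B HB] := @grad_error_bound R n N Psi Psis M%:R cG cGs.
  apply: (noise_filter_cvg0 (rho := rho) (l := l) (B := `|B|) (g := g M i) N0 iid hf_adm hl).
  - move=> c s; rewrite /g; case: ifP => [sM|_]; last by rewrite normr0.
    apply: le_trans (ler_norm_coord _ _) _; apply: le_trans (HB _ _ sM) _; exact: ler_norm.
  - move=> s; rewrite /g; case: (`|word_q y X s| <= M%:R); last by rewrite big1.
    transitivity ((\sum_c (grad (Psis c) (word_q y X s) - grad Psi (word_q y X s))) 0 i).
      by rewrite summxE.
    by rewrite sumrB (sum_grad N0 PsiE dPsi dPsis) sumr_const card_ord scaler_nat subrr mxE.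
  - by [].
(* Coordinates are indexed by naturals to form a countable union; an index [j >= n] contributes the
   empty set. *)
have badU : P.-negligible (\bigcup_M \bigcup_j [set w | exists2 i : 'I_n, (i : nat) = j & bad M i w]).
  apply: negligible_bigcup => M; apply: negligible_bigcup => j.
  have [jn|jn] := ltnP j n.
    apply: (negligibleS _ (badN M (Ordinal jn))) => w [i ij].
    by rewrite (_ : i = Ordinal jn)//; exact: val_inj.
  rewrite (_ : mkset _ = set0); first exact: negligible_set0.
  by apply/seteqP; split => // w [i ij _]; move: jn; rewrite -ij leqNgt ltn_ord.
apply: negligibleS (negligibleU bad0 badU) => w [Ow notgood].
have [good|] := pselect (hbounded (X w) /\ hcomplete (X w)); last by left.
right; apply: contrapT => nbad; apply: notgood.
have [[M0 HM0] _] := good; pose M := (Num.truncn `|M0|).+1.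
have HM k j : hd (X w) (k, j) -> `|hv (X w) k j| <= M%:R.
  move=> /HM0 /le_trans; apply; apply: le_trans (ler_norm _) _.
  by rewrite ltW// truncnS_gt.
have vcvg i : (fun k => v M i (word y k w)) @ \oo --> (0 : R).
  by apply: contrapT => nv; apply: nbad; exists M => //; exists (val i) => //; exists i.
have qM k : `|slow_q (X w) k| <= M%:R.
  by apply: le_trans (HM _ _ (Xdom w k)); rewrite !prod_normE !le_max lexx.
have pM k : `|slow_p (X w) k| <= M%:R.
  by apply: le_trans (HM _ _ (Xdom w k)); rewrite !prod_normE !le_max lexx !orbT.
have err : (fun k => fast_x (X w) k - grad Psi (slow_q (X w) k)) @ \oo --> (0 : 'rV[R]_n).
  apply: (fast_error_cvg0 (p := slow_p (X w)) (v := fun i k => v M i (word y k w))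
    (gam := fun k => grad (Psis (y k.+1 w)) (slow_q (X w) k)) L0 lipG adm pM) => //.
  - by move=> k; exact: (slow_qS T0 (cX w) (gam := fun k q => grad (Psis (y k w)) q) (flowX w) (jumpX w)).
  - by move=> k; exact: (fast_xS T0 (cX w) (gam := fun k q => grad (Psis (y k w)) q) (flowX w) (jumpX w)).
  (* The bound [qM] keeps the truncation inactive on this path. *)
  - by move=> i k; rewrite /v /= size_word /g wq qM.
split.
  exact: (solution_asymptotic_simulation (gam := fun k q => grad (Psis (y k w)) q)
    T0 hs_adm (cX w) (flowX w) (jumpX w) kappa0 cG HM err).
exact: (omega_limit_Mset (gam := fun k q => grad (Psis (y k w)) q)
    T0 hs_adm (cX w) (flowX w) (jumpX w) kappa0 L0 dPsi cG lipG crit HM err xminP).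
Qed.
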